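(* There exists a constant $c_{3,3}$ with $0.6224\leq c_{3,3}\leq 0.6420$ such that $f_{3,3}(n)=(c_{3,3}+o(1))n$ as $n\to\infty$.
   Context: For integers $k\ge1$, $d\ge 2$, $n\ge1$, $f_{k,d}(n)$ is the maximal size of a set $A\subseteq\{1,\dots,n\}$ such that the equation $a_1a_2\cdots a_k=x^d$ (with $a_1,\dots,a_k\in A$ not necessarily distinct, $x$ an integer) has no solution except trivial ones, where a solution is trivial if the multiset $\{a_1,\dots,a_k\}$ can be partitioned into $d$-element sub-multisets each consisting of $d$ copies of the same number. *)

(* Defs.v *)
From mathcomp Require Import all_boot all_order all_algebra.
From mathcomp Require Import boolp.

Set Implicit Arguments.
Unset Strict Implicit.
Unset Printing Implicit Defensive.

Import Order.TTheory GRing.Theory Num.Theory.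

Local Open Scope ring_scope.

(* Partitioning the multiset {a_1, ..., a_k} amounts to partitioning the
   index set 'I_k. *)
Definition trivial_solution (k d : nat) (a : 'I_k -> nat) : Prop :=
  exists P : {set {set 'I_k}},
    partition P [set: 'I_k] /\
    (forall B : {set 'I_k}, B \in P ->
       #|B| = d /\ (forall i j : 'I_k, i \in B -> j \in B -> a i = a j)).

Definition only_trivial_solutions (k d n : nat) (A : {set 'I_n.+1}) : Prop :=
  forall (a : 'I_k -> 'I_n.+1) (x : int),
    (forall i, a i \in A) ->
    (\prod_(i < k) a i)%N%:Z = x ^+ d ->
    trivial_solution d (fun i => a i).

(* Subsets of {1, ..., n} are encoded as the sets of ordinals of 'I_n.+1
   that do not contain 0.  For k >= 1 the empty set is always admissible, so
   the default value 0 of the maximum plays no role. *)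
Definition fmax (k d n : nat) : nat :=
  (\max_(A : {set 'I_n.+1} |
      (ord0 \notin A) && `[< only_trivial_solutions k d A >]) #|A|)%N.

(* Main.v *)
(** A solution of a1 a2 a3 = x^3 is trivial iff a1 = a2 = a3, so the admissible
    sets are those without three elements, not all equal, whose product is a
    cube: modulo cubes they are cap sets. Fix W > 0 and write m = t q k^3 with
    t coprime to W and q a divisor of W^2. For fixed t the parts q of the
    elements of an admissible set form an admissible set of divisors of W^2
    that are at most n / t; conversely, admissible sets C_t of such divisors
    may be glued to the union of the sets t C_t as long as t is squarefree. If
    F(z) is the largest size of an admissible set of divisors of W^2 up to z,
    this gives, with S(n) the sum of F(n / t) over the t <= n coprime to W,
      S(n) - sum over the primes p not dividing W of S(n / p^2)
        <= f(n) <= S(n).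
    As F is a bounded step function, S(n) = V n + O(1), where V is phi(W) / W
    times the sum of 1 / z over the jumps z of F. For W = y! the error term is
    at most n / y, hence f(n) / n is a Cauchy sequence. The upper bound on its
    limit comes from W = 210, where F is at most the step function with the
    jumps 1, 2, 3, 5, ..., 294, and the lower bound from explicit caps for
    W = 2310. *)

From HB Require Import structures.
From Stdlib Require Import NArith Ascii String.
Require Import Defs.
From mathcomp Require Import all_boot all_order all_algebra.
From mathcomp Require Import boolp.
From mathcomp Require Import zify ring lra.

Set Implicit Arguments.
Unset Strict Implicit.
Unset Printing Implicit Defensive.

(** * Caps in F_3^k *)

Inductive trit := T0 | T1 | T2.

Definition trit_eqb (a b : trit) : bool :=
  match a, b with T0, T0 | T1, T1 | T2, T2 => true | _, _ => false end.

Lemma trit_eqP : Equality.axiom trit_eqb.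
Proof. by case; case; constructor. Qed.

HB.instance Definition _ := hasDecEq.Build trit trit_eqP.

Definition topp (a : trit) : trit :=
  match a with T0 => T0 | T1 => T2 | T2 => T1 end.
Definition tadd (a b : trit) : trit :=
  match a, b with
  | T0, _ => b
  | _, T0 => a
  | T1, T1 => T2
  | T2, T2 => T1
  | _, _ => T0
  end.
Definition tmul (a b : trit) : trit :=
  match a with T0 => T0 | T1 => b | T2 => topp b end.
Definition tthird (a b : trit) : trit := topp (tadd a b).

Definition trits : seq trit := [:: T0; T1; T2].

Lemma mem_trits t : t \in trits. Proof. by case: t. Qed.

Fixpoint pts (k : nat) : seq (seq trit) :=
  if k is k'.+1 then [seq t :: x | t <- trits, x <- pts k'] else [:: [::]].

Fixpoint dot (w x : seq trit) : trit :=
  match w, x with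
  | a :: w', b :: x' => tadd (tmul a b) (dot w' x')
  | _, _ => T0
  end.

Fixpoint third (x y : seq trit) : seq trit :=
  match x, y with
  | a :: x', b :: y' => tthird a b :: third x' y'
  | _, _ => [::]
  end.

Lemma ptsS k : pts k.+1 = [seq t :: x | t <- trits, x <- pts k].
Proof. by []. Qed.

Lemma mem_pts k x : (x \in pts k) = (size x == k).
Proof.
elim: k x => [|k IH] [|t x]; rewrite ?ptsS //.
  by apply/negbTE/negP => /allpairsP[[u v] [_ _]].
rewrite [RHS]eqSS -IH; apply/allpairsP/idP => [[[u v] [_ h [_ ->]]] //|h].
by exists (t, x); rewrite mem_trits.
Qed.

Lemma uniq_pts k : uniq (pts k).
Proof.
elim: k => // k IH; rewrite ptsS; apply: (@allpairs_uniq _ _ _ cons) => //.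
by move=> [a b] [c d] _ _ /= [-> ->].
Qed.

Lemma size_third k x y : size x = k -> size y = k -> size (third x y) = k.
Proof. by elim: k x y => [|k IH] [|a x] [|b y] //= [hx] [hy]; rewrite (IH x y). Qed.

(* Over F_3 the third point -(x + y) of the line through x <> y is also the
   condition for x, y and it to sum to zero, so caps are the sets without
   nontrivial solutions of x + y + z = 0. *)
Definition cap (k : nat) (B : pred (seq trit)) : Prop :=
  forall x y, size x = k -> size y = k ->
    B x -> B y -> B (third x y) -> x = y.

(* Vectors whose first nonzero coordinate is 1: one normal vector for each
   parallel class of hyperplanes. *)
Fixpoint normalized (w : seq trit) : bool :=
  match w with T1 :: _ => true | T0 :: w' => normalized w' | _ => false end.

Definition dirs (k : nat) : seq (seq trit) := [seq w <- pts k | normalized w].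

(* Affine parametrization of the hyperplane dot w x = c, w normalized. *)
Fixpoint phi (w : seq trit) (c : trit) (x : seq trit) : seq trit :=
  match w with
  | T0 :: w' => if x is t :: x' then t :: phi w' c x' else [::]
  | _ :: w' => tadd c (topp (dot w' x)) :: x
  | [::] => [::]
  end.

Lemma size_phi w c x k : normalized w -> size w = k.+1 -> size x = k ->
  size (phi w c x) = k.+1.
Proof.
elim: w x k => [|a w IH] x k //= nw [sw] sx.
case: a nw => //= nw; last by rewrite sx.
case: k sw sx => [|k]; first by case: (w) nw.
by case: x => [|b x] //= sw [sx]; rewrite (IH x k).
Qed.

Lemma dot_third w x y k : size x = k -> size y = k -> size w = k ->
  dot w (third x y) = tthird (dot w x) (dot w y).
Proof.
elim: w x y k => [|a w IH] [|b x] [|c y] [|k] //= [hx] [hy] [hw].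
by rewrite (IH x y k) //; case: a b c (dot w x) (dot w y) => -[] [] [] [].
Qed.

Lemma phi_third w c x y k : normalized w -> size w = k.+1 ->
  size x = k -> size y = k ->
  phi w c (third x y) = third (phi w c x) (phi w c y).
Proof.
elim: w x y k => [|a w IH] x y k //= nw [sw] sx sy.
case: a nw => // nw.
  case: k sw sx sy => [|k]; first by case: (w) nw.
  by case: x y => [|a x] [|b y] // sw [sx] [sy] /=; rewrite (IH x y k).
rewrite /= (@dot_third w x y k) //.
by case: (c) (dot w x) (dot w y) => -[] [].
Qed.

Lemma phi_inj w c x y k : normalized w -> size w = k.+1 ->
  size x = k -> size y = k -> phi w c x = phi w c y -> x = y.
Proof.
elim: w x y k => [|a w IH] x y k //= nw [sw] sx sy.
case: a nw => // nw; last by case.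
case: k sw sx sy => [|k]; first by case: (w) nw.
case: x y => [|a x] [|b y] // sw [sx] [sy] [-> h].
by rewrite (IH x y k).
Qed.

Lemma phi_surj w c x k : normalized w -> size w = k.+1 -> size x = k.+1 ->
  dot w x = c -> exists2 y, size y = k & x = phi w c y.
Proof.
elim: w x k => [|a w IH] [|t x] k //= nw [sw] [sx].
case: a nw => //= nw; last first.
  move=> <-; exists x => //; congr (_ :: _).
  by case: t (dot w x) => -[].
case: k sw sx => [|k sw sx h]; first by case: (w) nw.
have [|y sy ->] := IH x k nw sw sx; first by rewrite -h; case: (dot w x).
by exists (t :: y) => //=; rewrite sy.
Qed.

Lemma cap_phi w c k B : normalized w -> size w = k.+1 -> cap k.+1 B ->
  cap k (B \o phi w c).
Proof.
move=> nw sw cB x y sx sy /= Bx By; rewrite (@phi_third w c x y k) // => Bt.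
by apply: (@phi_inj w c x y k) => //; apply: cB => //; exact: size_phi.
Qed.

Lemma count_hyperplane w c k B : normalized w -> size w = k.+1 ->
  count (fun x => B x && (dot w x == c)) (pts k.+1) <=
  count (B \o phi w c) (pts k).
Proof.
move=> nw sw; rewrite -size_filter -count_map -size_filter.
apply: uniq_leq_size; first by rewrite filter_uniq ?uniq_pts.
move=> x; rewrite !mem_filter mem_pts => /andP[/andP[-> /eqP dx] /eqP sx] /=.
have [y sy ->] := phi_surj nw sw sx dx.
by apply: map_f; rewrite mem_pts sy.
Qed.

(** * Moments of the hyperplane sections of a set *)

Definition tsub (a b : trit) : trit := tadd a (topp b).
Fixpoint vsub (x y : seq trit) : seq trit :=
  match x, y with
  | a :: x', b :: y' => tsub a b :: vsub x' y'
  | _, _ => [::]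
  end.

Lemma size_vsub k x y : size x = k -> size y = k -> size (vsub x y) = k.
Proof. by elim: k x y => [|k IH] [|a x] [|b y] //= [hx] [hy]; rewrite (IH x y). Qed.

Lemma dot_vsub w x y k : size x = k -> size y = k -> size w = k ->
  dot w (vsub x y) = tsub (dot w x) (dot w y).
Proof.
elim: w x y k => [|a w IH] [|b x] [|c y] [|k] //= [hx] [hy] [hw].
by rewrite (IH x y k) //; case: a b c (dot w x) (dot w y) => -[] [] [] [].
Qed.

Lemma dot_eq w x y k : size x = k -> size y = k -> size w = k ->
  (dot w x == dot w y) = (dot w (vsub y x) == T0).
Proof.
move=> sx sy sw; rewrite (@dot_vsub w y x k) //.
by case: (dot w x) (dot w y) => -[].
Qed.

Lemma vsub_inj k x y z : size x = k -> size y = k -> size z = k ->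
  vsub y x = vsub z x -> y = z.
Proof.
elim: k x y z => [|k IH] [|a x] [|b y] [|c z] //= [sx] [sy] [sz] [h1 h2].
by rewrite (IH x y z) //; case: a b c h1 => -[] [].
Qed.

Lemma vsub_self x : vsub x x = nseq (size x) T0.
Proof. by elim: x => //= a x ->; case: a. Qed.

Lemma vsub_third k x y z : size x = k -> size y = k -> size z = k ->
  vsub z x = map topp (vsub y x) -> x = third y z.
Proof.
elim: k x y z => [|k IH] [|a x] [|b y] [|c z] //= [sx] [sy] [sz] [h1 h2].
by rewrite (IH x y z) //; case: a b c h1 => -[] [].
Qed.

Definition pair_dirs (k c : nat) : bool :=
  all (fun u => (u == nseq k T0) || (count (fun w => dot w u == T0) (dirs k) == c))
      (pts k).

(** Over F_3 two nonzero vectors u and v are dependent only if v = u or v = -u. These cases are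
    excluded, so the count concerns a subspace of codimension 2. *)
Definition triple_dirs (k c : nat) : bool :=
  all (fun u => (u == nseq k T0) ||
    all (fun v => [|| v == nseq k T0, v == u, v == map topp u |
           count (fun w => (dot w u == T0) && (dot w v == T0)) (dirs k) == c])
      (pts k)) (pts k).

(** A hyperplane of F_3^4 through 0 contains (27 - 1) / 2 = 13 normalized vectors, a plane through 0
    contains (9 - 1) / 2 = 4. *)
Lemma pair_dirs4 : pair_dirs 4 13. Proof. by vm_compute. Qed.
Lemma triple_dirs4 : triple_dirs 4 4. Proof. by vm_compute. Qed.

Lemma count_pair_dirs k c x y : pair_dirs k c -> size x = k -> size y = k ->
  x != y -> count (fun w => dot w x == dot w y) (dirs k) = c.
Proof.
move=> /allP H sx sy xy.
have := H (vsub y x); rewrite mem_pts (@size_vsub k) // eqxx => /(_ isT).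
case/orP => [/eqP h|/eqP <-].
  case/eqP: xy; apply/esym; apply: (@vsub_inj k x) => //.
  by rewrite h vsub_self sx.
apply: eq_in_count => w; rewrite mem_filter mem_pts => /andP[_ /eqP sw].
exact: (@dot_eq w _ _ k).
Qed.

(** The directions counted are orthogonal to y - x and z - x, and these differences are independent
    because x, y, z are not on a line. *)
Lemma count_triple_dirs k c x y z : triple_dirs k c ->
  size x = k -> size y = k -> size z = k ->
  x != y -> x != z -> y != z -> x != third y z ->
  count (fun w => (dot w x == dot w y) && (dot w x == dot w z)) (dirs k) = c.
Proof.
move=> /allP H sx sy sz xy xz yz xt.
have nz u : size u = k -> x != u -> vsub u x != nseq k T0.
  move=> su; apply: contra => /eqP h; apply/eqP/esym.
  by apply: (@vsub_inj k x) => //; rewrite h vsub_self sx.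
have := H (vsub y x); rewrite mem_pts (@size_vsub k) // eqxx => /(_ isT).
rewrite (negPf (nz _ sy xy)) => /allP/(_ (vsub z x)).
rewrite mem_pts (@size_vsub k) // eqxx => /(_ isT).
rewrite (negPf (nz _ sz xz)) /= => /or3P[/eqP h|/eqP h|/eqP <-].
- by case/eqP: yz; apply/esym; apply: (@vsub_inj k x).
- by case/eqP: xt; apply: (@vsub_third k).
apply: eq_in_count => w; rewrite mem_filter mem_pts => /andP[_ /eqP sw].
by rewrite !(@dot_eq w _ _ k).
Qed.

Lemma sum_uniq_eq (T : eqType) (s : seq T) (x : T) (F : T -> nat) b :
  uniq s -> x \in s -> (forall y, y \in s -> y != x -> F y = b) ->
  \sum_(y <- s) F y = F x + (size s).-1 * b.
Proof.
move=> us xs hF; rewrite (big_rem x) //=; congr addn.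
rewrite (eq_big_seq (fun=> b)) => [|y].
  by rewrite big_const_seq count_predT size_rem // iter_addn_0 mulnC.
by rewrite (mem_rem_uniq _ us) inE => /andP[yx ys]; exact: hF.
Qed.

Lemma sum_count (S T : Type) (s : seq S) (r : seq T) (P : S -> T -> bool) :
  \sum_(x <- s) count (P x) r = \sum_(y <- r) count (fun x => P x y) s.
Proof.
rewrite (eq_bigr (fun x => \sum_(y <- r) nat_of_bool (P x y))).
  rewrite exchange_big; apply: eq_bigr => y _.
  by rewrite -sum1_count [RHS]big_mkcond; apply: eq_bigr => x _; case: (P x y).
by move=> x _; rewrite -sum1_count big_mkcond; apply: eq_bigr => y _; case: (P x y).
Qed.

(** The size of the section of s through x normal to w. Summed over x in s, its e-th power yields
    the sum of the (e + 1)-st powers of the three section sizes. *)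
Definition fib (s : seq (seq trit)) (w x : seq trit) : nat :=
  count (fun y => dot w x == dot w y) s.

Lemma sum_dot s w (F : trit -> nat) :
  \sum_(x <- s) F (dot w x) =
  count (fun x => dot w x == T0) s * F T0 +
  count (fun x => dot w x == T1) s * F T1 +
  count (fun x => dot w x == T2) s * F T2.
Proof.
elim: s => [|x r IH]; first by rewrite big_nil.
by rewrite big_cons IH /=; case: (dot w x) => /=; lia.
Qed.

Lemma fibE s w x : fib s w x = count (fun y => dot w y == dot w x) s.
Proof. by apply: eq_count => y; rewrite eq_sym. Qed.

Lemma size_dot s w :
  size s = count (fun x => dot w x == T0) s + count (fun x => dot w x == T1) s +
           count (fun x => dot w x == T2) s.
Proof. by have := sum_dot s w (fun=> 1); rewrite sum1_size !muln1. Qed.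

Section Moments.

Variables (k : nat) (s : seq (seq trit)).
Hypotheses (us : uniq s) (ss : forall x, x \in s -> size x = k).

Let D := size (dirs k).

(** Double counting of pairs (x, y) in a common section: all D directions serve if y = x, and c of
    them otherwise. *)
Lemma sum_fib c : pair_dirs k c ->
  \sum_(w <- dirs k) \sum_(x <- s) fib s w x =
  size s * (D + (size s).-1 * c).
Proof.
move=> kc; rewrite exchange_big /= mulnC.
rewrite (eq_big_seq (fun=> D + (size s).-1 * c)) => [|x xs].
  by rewrite big_const_seq count_predT iter_addn_0.
rewrite sum_count (@sum_uniq_eq _ s x _ c) //.
  congr addn; rewrite -[D]/(size (dirs k)) -count_predT; apply: eq_count => w.
  exact: eqxx.
by move=> y ys yx; apply: count_pair_dirs; rewrite ?ss // eq_sym.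
Qed.

(** The same count for triples (x, y, z). Two coinciding points reduce it to pairs; three distinct
    points of a cap are never collinear, so exactly t directions serve. *)
Lemma sum_fib2 c t : pair_dirs k c -> triple_dirs k t ->
  (forall x y, x \in s -> y \in s -> x != y -> third x y \notin s) ->
  \sum_(w <- dirs k) \sum_(x <- s) fib s w x ^ 2 =
  size s * (D + (size s).-1 * c + (size s).-1 * (c + (c + (size s).-2 * t))).
Proof.
move=> kc kt capS; rewrite exchange_big /= mulnC.
rewrite (eq_big_seq (fun=> D + (size s).-1 * c +
    (size s).-1 * (c + (c + (size s).-2 * t)))) => [|x xs].
  by rewrite big_const_seq count_predT iter_addn_0.
pose g y z := count (fun w => (dot w x == dot w y) && (dot w x == dot w z)) (dirs k).
have -> : \sum_(w <- dirs k) fib s w x ^ 2 = \sum_(y <- s) \sum_(z <- s) g y z.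
  under [RHS]eq_bigr => y _ do rewrite -sum_count.
  rewrite exchange_big; apply: eq_bigr => w _ /=.
  rewrite -mulnn {1}/fib -sum1_count big_distrl /= big_mkcond.
  apply: eq_bigr => y _ /=; rewrite mul1n.
  by case: (dot w x == dot w y) => //=; rewrite count_pred0.
have gx z : z \in s -> z != x -> g x z = c.
  move=> zs zx; rewrite -(count_pair_dirs kc (ss xs) (ss zs)) 1?eq_sym //.
  by apply: eq_count => w /=; rewrite eqxx.
rewrite (@sum_uniq_eq _ s x _ (c + (c + (size s).-2 * t))) //.
  congr (_ + _); rewrite (@sum_uniq_eq _ s x _ c) //; congr addn.
  rewrite -[D]/(size (dirs k)) -count_predT; apply: eq_count => w /=.
  by rewrite eqxx.
move=> y ys yx; rewrite (big_rem x) //=; congr addn.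
  rewrite -(gx y) //; apply: eq_count => w; exact: andbC.
rewrite (@sum_uniq_eq _ _ y _ t) ?rem_uniq ?(mem_rem_uniq _ us) ?inE ?yx //.
  rewrite size_rem //; congr addn; rewrite -(gx y) //.
  by apply: eq_count => w; rewrite eqxx andbb.
move=> z; rewrite (mem_rem_uniq _ us) inE => /andP[zx zs] zy.
apply: count_triple_dirs kt _ _ _ _ _ _ _; rewrite ?ss // 1?[x == y]eq_sym
  1?[x == z]eq_sym 1?[y == z]eq_sym //.
by apply/eqP => xt; have := capS _ _ ys zs; rewrite -xt xs eq_sym zy => /(_ isT).
Qed.

End Moments.

(** * Upper bounds for caps in dimensions 1 to 4 *)

Lemma mem_dirs k w : w \in dirs k -> normalized w /\ size w = k.
Proof. by rewrite mem_filter mem_pts => /andP[-> /eqP]. Qed.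

(** Cuts a large cap down to exactly N points, so that the moment identities become equations
    between numerals. *)
Lemma subcap k B N : cap k B -> N <= count B (pts k) ->
  exists s, [/\ uniq s, size s = N, (forall x, x \in s -> size x = k),
    (forall x, x \in s -> B x) &
    (forall P, count P s <= count (fun x => B x && P x) (pts k))].
Proof.
move=> cB; rewrite -size_filter => hN; exists (take N (filter B (pts k))).
have sub x : x \in take N (filter B (pts k)) -> B x && (size x == k).
  by move=> /mem_take; rewrite mem_filter mem_pts.
split; first by rewrite take_uniq // filter_uniq // uniq_pts.
- exact: size_takel.
- by move=> x /sub/andP[_ /eqP].
- by move=> x /sub/andP[].
move=> P; rewrite -[in X in _ <= X](eq_count (a1 := predI P B)).
  by rewrite -count_filter -[X in _ <= count _ X](cat_take_drop N) count_cat leq_addr.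
by move=> x /=; rewrite andbC.
Qed.

(** A second moment argument. The sections of a cap are caps of size at most M, so for N points each
    direction has a sum of squares of at most Q; the total over all directions, given by [sum_fib],
    is larger. *)
Lemma cap_bound_step k M N Q c (B : pred (seq trit)) :
  (forall B', cap k B' -> count B' (pts k) <= M) ->
  (forall a b d, a <= M -> b <= M -> d <= M -> a + b + d = N ->
     a * a + b * b + d * d <= Q) ->
  pair_dirs k.+1 c -> size (dirs k.+1) * Q < N * (size (dirs k.+1) + N.-1 * c) ->
  cap k.+1 B -> count B (pts k.+1) < N.
Proof.
move=> hM hQ kc hlt cB; rewrite ltnNge; apply/negP => hN.
have [s [us sN ss sB sP]] := subcap cB hN.
move: hlt; rewrite -sN -(sum_fib us ss kc) ltnNge => /negP; apply.
rewrite mulnC -[size (dirs _)]count_predT -iter_addn_0 -big_const_seq.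
rewrite !big_seq; apply: leq_sum => w /mem_dirs[nw sw].
under eq_bigr => x _ do rewrite fibE.
rewrite (sum_dot s w (fun t => count (fun y => dot w y == t) s)).
have h t : count (fun x => dot w x == t) s <= M.
  apply: leq_trans (sP _) _; apply: leq_trans (count_hyperplane _ _ nw sw) _.
  exact/hM/cap_phi.
by apply: hQ; rewrite // -size_dot.
Qed.

Lemma cap1 B : cap 1 B -> count B (pts 1) <= 2.
Proof.
move=> cB; have /= := cB [:: T0] [:: T1] erefl erefl.
by case: (B [:: T0]) (B [:: T1]) (B [:: T2]) => -[] [] // /(_ isT isT isT).
Qed.

Lemma cap2 B : cap 2 B -> count B (pts 2) <= 4.
Proof.
move=> cB; rewrite -ltnS; move: cB.
(* The sections of 5 points have sizes 2, 2, 1, and 4 * 9 < 5 * (4 + 4 * 1). *)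
apply: (cap_bound_step (k := 1) (N := 5) (Q := 9) (M := 2) (c := 1) cap1) => //.
by case=> [|[|[|a]]] [|[|[|b]]] // [|[|[|d]]].
Qed.

Lemma cap3 B : cap 3 B -> count B (pts 3) <= 9.
Proof.
move=> cB; rewrite -ltnS; move: cB.
(* The extreme sections of 10 points have sizes 4, 4, 2, and 13 * 36 < 10 * (13 + 9 * 4). *)
apply: (cap_bound_step (k := 2) (N := 10) (Q := 36) (M := 4) (c := 4) cap2) => //.
by case=> [|[|[|[|[|a]]]]] [|[|[|[|[|b]]]]] // [|[|[|[|[|d]]]]].
Qed.

(* Three hyperplane sections of sizes at most 9 and total 21 satisfy this with
   equality only for sizes 7, 7, 7 and 9, 9, 3. *)
Lemma moment_ineq a b d : a <= 9 -> b <= 9 -> d <= 9 -> a + b + d = 21 ->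
  let p := a * a + b * b + d * d in
  let q := a * a ^ 2 + b * b ^ 2 + d * d ^ 2 in
  19 * p <= q + 1764 /\ (q + 1764 = 19 * p -> p %% 24 = 3).
Proof.
move=> ha hb hd h; have -> : d = 21 - (a + b) by lia.
have ab : 12 <= a + b by lia.
pose P x y z := let p := x * x + y * y + z * z in
  let q := x * x ^ 2 + y * y ^ 2 + z * z ^ 2 in
  (19 * p <= q + 1764) && ((q + 1764 == 19 * p) ==> (p %% 24 == 3)).
have /allP/(_ a) : all (fun x => all (fun y => (12 <= x + y) ==> P x y (21 - (x + y)))
    (iota 0 10)) (iota 0 10) by vm_compute.
rewrite mem_iota leq0n add0n ltnS ha => /(_ isT)/allP/(_ b).
rewrite mem_iota leq0n add0n ltnS hb ab => /(_ isT)/andP[h1 /implyP e] /=.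
by split=> // /eqP/e/eqP.
Qed.

(* The second and third moments of a 21-cap force equality in moment_ineq for
   each of the 40 directions, which contradicts the second moment modulo 24. *)
Lemma cap4 B : cap 4 B -> count B (pts 4) <= 20.
Proof.
move=> cB; rewrite -ltnS ltnNge; apply/negP => hN.
have [s [us sN ss sB sP]] := subcap cB hN.
pose n w t := count (fun y => dot w y == t) s.
have nb w t : w \in dirs 4 -> n w t <= 9.
  move=> /mem_dirs[nw sw]; apply: leq_trans (sP _) _.
  by apply: leq_trans (count_hyperplane _ _ nw sw) _; apply/cap3/cap_phi.
pose p w := n w T0 * n w T0 + n w T1 * n w T1 + n w T2 * n w T2.
pose q w := n w T0 * n w T0 ^ 2 + n w T1 * n w T1 ^ 2 + n w T2 * n w T2 ^ 2.
have Ep : \sum_(w <- dirs 4) p w = 21 * 300.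
  transitivity (size s * (40 + (size s).-1 * 13)); last by rewrite sN.
  rewrite -(sum_fib us ss pair_dirs4); apply: eq_bigr => w _.
  under eq_bigr => x _ do rewrite fibE.
  by rewrite (sum_dot s w (n w)).
have Eq : \sum_(w <- dirs 4) q w = 21 * 2340.
  transitivity (size s * (40 + (size s).-1 * 13 +
      (size s).-1 * (13 + (13 + (size s).-2 * 4)))); last by rewrite sN.
  rewrite -(sum_fib2 us ss pair_dirs4 triple_dirs4); last first.
    move=> x y xs ys; apply: contra => /sB Bt; apply/eqP.
    by apply: cB Bt; [exact: ss|exact: ss|exact: sB|exact: sB].
  apply: eq_bigr => w _; under eq_bigr => x _ do rewrite fibE.
  by rewrite (sum_dot s w (fun t => n w t ^ 2)).
(* By [moment_ineq] this subtraction does not truncate. *)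
pose e w := q w + 1764 - 19 * p w.
have he w : w \in dirs 4 ->
    q w + 1764 = 19 * p w + e w /\ (e w = 0 -> p w %% 24 = 3).
  move=> wD; have := moment_ineq (nb w T0 wD) (nb w T1 wD) (nb w T2 wD).
  rewrite -size_dot sN => /(_ erefl); rewrite /= -/(q w) -/(p w) => -[h1 h2].
  by rewrite /e; split=> [|h]; [lia | apply: h2; lia].
clearbody p q.
(* The moments match exactly: 21 * 2340 + 40 * 1764 = 19 * 21 * 300. *)
have : \sum_(w <- dirs 4) e w = 0.
  have : \sum_(w <- dirs 4) (q w + 1764) = \sum_(w <- dirs 4) (19 * p w + e w).
    by rewrite !big_seq; apply: eq_bigr => w /he[].
  have E19 : \sum_(w <- dirs 4) 19 * p w = 19 * (21 * 300) by rewrite -Ep big_distrr.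
  rewrite [LHS]big_split [RHS]big_split Eq E19 big_const_seq count_predT iter_addn_0.
  have -> : size (dirs 4) = 40 by [].
  move: (\sum_(w <- dirs 4) e w) => S h.
  have {}h : 21 * 2340 + 1764 * 40 = 19 * (21 * 300) + S := h.
  lia.
move=> /eqP; rewrite sum_nat_seq_eq0 => /allP e0.
(* The left sum is 6300, which is 12 modulo 24, whereas 40 * 3 is 0 modulo 24. *)
have : (\sum_(w <- dirs 4) p w) %% 24 = (\sum_(w <- dirs 4) 3) %% 24.
  rewrite -modn_summ -[in RHS]modn_summ; congr (_ %% _); rewrite !big_seq.
  by apply: eq_bigr => w wD; rewrite (he w wD).2 //; apply/eqP/(e0 w wD).
by rewrite Ep big_const_seq count_predT.
Qed.

(** * A decision tree bounding caps with small values *)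

(** Sets of points as ternary trees: lookup and removal follow a single path, which keeps the
    evaluation of the certificates cheap. *)
Inductive trie := Leaf of bool | Node of trie & trie & trie.

Fixpoint lookup (a : trie) (x : seq trit) : bool :=
  match a, x with
  | Node a0 a1 a2, t :: x' =>
      lookup (match t with T0 => a0 | T1 => a1 | T2 => a2 end) x'
  | Node _ _ _, [::] => false
  | Leaf b, _ => b
  end.

Fixpoint remove (a : trie) (x : seq trit) : trie :=
  match a, x with
  | Node a0 a1 a2, t :: x' =>
      match t with
      | T0 => Node (remove a0 x') a1 a2
      | T1 => Node a0 (remove a1 x') a2
      | T2 => Node a0 a1 (remove a2 x')
      end
  | Leaf _, [::] => Leaf false
  | _, _ => a
  end.

Fixpoint build (k : nat) (f : seq trit -> bool) : trie :=
  if k is k'.+1 then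
    Node (build k' (fun x => f (T0 :: x))) (build k' (fun x => f (T1 :: x)))
         (build k' (fun x => f (T2 :: x)))
  else Leaf (f [::]).

Lemma lookup_build k f x : size x = k -> lookup (build k f) x = f x.
Proof. by elim: k f x => [|k IH] f [|[] x] //= [sx]; rewrite IH. Qed.

Lemma lookup_remove a x y : size x = size y -> y != x ->
  lookup a y -> lookup (remove a x) y.
Proof.
elim: a x y => [b|a0 IH0 a1 IH1 a2 IH2] [|t x] [|u y] //= [sxy].
rewrite eqseq_cons negb_and.
by case: t; case: u => //= yx; [exact: IH0|exact: IH1|exact: IH2].
Qed.

(* Size of a largest cap inside a set of points of a plane. *)
Definition plane_bound (l : seq (seq trit)) : nat :=
  let n := size l in
  if 4 < n then 4
  else if n < 3 then n
  else n - has (fun x => has (fun y => (x != y) && (third x y \in l)) l) l.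

(* A block is a hyperplane (true) or a plane (false). *)
Definition block_bound (a : trie) (b : bool * seq (seq trit)) : nat :=
  let l := filter (lookup a) b.2 in
  if b.1 then minn 9 (size l) else plane_bound l.

(* The partition of F_3^4 into the hyperplanes normal to w, some of which are
   split further into three parallel planes. *)
Definition blocks (p : seq trit * seq (option (seq trit))) :
    seq (bool * seq (seq trit)) :=
  let: (w, us) := p in
  flatten [seq
    if nth None us i is Some u then
      [seq (false, [seq phi w (nth T0 trits i) x | x <- pts 3 & dot u x == t])
         | t <- trits]
    else [:: (true, [seq phi w (nth T0 trits i) x | x <- pts 3])]
  | i <- iota 0 3].

Definition wf_partition (p : seq trit * seq (option (seq trit))) : bool :=
  (p.1 \in dirs 4) && all (fun o => if o is Some u then u \in dirs 3 else true) p.2.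

(** A cap that contains x and y avoids the third point of their line. For y = x that point would be
    x itself, so nothing is removed. *)
Definition restrict (x y : seq trit) (a : trie) : trie :=
  if x == y then a else remove a (third x y).

Definition state := (trie * seq (seq trit))%type.

(* A certificate is the prefix traversal of a binary decision tree. A letter
   branches on whether the point with that index in ord is in the cap; a digit
   closes a branch by the partition with that number. A state consists of the
   points still available and of those chosen to be in the cap. *)
Fixpoint run (parts : seq (seq (bool * seq (seq trit)))) (ord : seq (seq trit))
    (target : nat) (cert : string) (stack : seq state) : bool :=
  match cert with
  | EmptyString => nilp stack
  | String c cert' =>
      let n := nat_of_ascii c in
      if n < 48 then run parts ord target cert' stack
      else match stack with
      | [::] => false
      | (a, ch) :: st =>
          if n < 65 then
            (n - 48 < size parts) &&
            (sumn (map (block_bound a) (nth [::] parts (n - 48))) < target) &&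
            run parts ord target cert' st
          else
            let x := nth (nseq 4 T0) ord (n - 65) in
            run parts ord target cert'
              ((foldr (restrict x) a ch, x :: ch) ::
               (remove a x, ch) :: st)
      end
  end.

Section Run.

Variable target : nat.

Definition closes (st : state) : Prop :=
  forall B, cap 4 B -> (forall x, size x = 4 -> B x -> lookup st.1 x) ->
    all B st.2 -> all (fun x => size x == 4) st.2 -> count B (pts 4) < target.

(** The bound 4 is an assumption since l lies in the ambient space, where [cap2] does not apply
    directly; [block_boundP] obtains it by parametrizing the plane. *)
Lemma plane_boundP k B l : cap k B -> uniq l ->
  (forall x, x \in l -> size x = k) -> count B l <= 4 ->
  count B l <= plane_bound l.
Proof.
move=> cB ul sl c4; rewrite /plane_bound; case: ifP => // _.
case: ifP => _; first exact: count_size.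
case: (boolP (has _ _)) => [|_]; last by rewrite subn0 count_size.
move=> /hasP[x xl /hasP[y yl /andP[xy tl]]].
have : ~~ all B l.
  apply: contra xy => /allP aB; apply/eqP.
  by apply: cB; rewrite ?sl ?aB.
by rewrite all_count => h; have := count_size B l; lia.
Qed.

Lemma block_cover B p : wf_partition p -> cap 4 B ->
  count B (pts 4) <= \sum_(b <- blocks p) count B b.2.
Proof.
case: p => w us /andP[/mem_dirs[nw sw] _] cB.
have hc (f : seq trit -> trit) (P : pred (seq trit)) (s : seq (seq trit)) :
    count P s = \sum_(t <- trits) count (fun x => P x && (f x == t)) s.
  rewrite unlock /= addn0; elim: s => //= x s ->.
  by case: (P x) => //=; case: (f x) => /=; lia.
have -> : blocks (w, us) = flatten [seq
    if nth None us i is Some u then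
      [seq (false, [seq phi w (nth T0 trits i) x | x <- pts 3 & dot u x == t])
         | t <- trits]
    else [:: (true, [seq phi w (nth T0 trits i) x | x <- pts 3])]
  | i <- iota 0 3] by [].
rewrite big_flatten big_map (hc (dot w)).
rewrite -[trits in X in X <= _](mkseq_nth T0) /mkseq big_map.
apply: leq_sum => i _.
apply: leq_trans (count_hyperplane _ _ nw sw) _.
case: (nth None us i) => [u|]; last by rewrite big_seq1 count_map.
rewrite big_map (hc (dot u)); apply: leq_sum => t _.
by rewrite count_map count_filter.
Qed.

(** The preimage of a cap under [phi] is a cap: one parametrization reduces a hyperplane block to
    [cap3], two reduce a plane block to [cap2]. *)
Lemma block_boundP B p a b : wf_partition p -> cap 4 B ->
  (forall x, size x = 4 -> B x -> lookup a x) -> b \in blocks p ->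
  count B b.2 <= block_bound a b.
Proof.
case: p => w us /andP[/mem_dirs[nw sw] /allP wus] cB Ba.
move=> /flatten_mapP[i _]; set c := nth T0 trits i.
have cBi := cap_phi (c := c) nw sw cB.
case E: (nth None us i) => [u|]; last first.
  rewrite inE => /eqP ->; set l := [seq phi w c x | x <- pts 3].
  rewrite -[block_bound _ _]/(minn 9 (size (filter (lookup a) l))) -[(_, l).2]/l.
  rewrite leq_min size_filter; apply/andP; split.
    by have := cap3 cBi; rewrite -count_map.
  have -> : count B l = count (predI B (lookup a)) l.
    apply: eq_in_count => x /mapP[y]; rewrite mem_pts => /eqP sy -> /=.
    by case Bx: (B _) => //=; rewrite Ba // (@size_phi _ _ _ 3).
  by apply: sub_count => x /andP[].
have /mem_dirs[nu su] : u \in dirs 3.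
  have /wus : Some u \in us.
    rewrite -E mem_nth // ltnNge; apply/negP => h.
    by rewrite nth_default in E.
  by [].
move=> /mapP[t _ ->]; set l := [seq phi w c x | x <- pts 3 & dot u x == t].
rewrite -[block_bound _ _]/(plane_bound (filter (lookup a) l)) -[(_, l).2]/l.
have sl x : x \in l -> size x = 4.
  move=> /mapP[y]; rewrite mem_filter mem_pts => /andP[_ /eqP sy] ->.
  exact: (@size_phi _ _ _ 3).
have ul : uniq l.
  rewrite map_inj_in_uniq ?filter_uniq ?uniq_pts // => x y.
  rewrite !mem_filter !mem_pts => /andP[_ /eqP sx] /andP[_ /eqP sy].
  exact: (@phi_inj _ _ _ _ 3).
have -> : count B l = count B (filter (lookup a) l).
  rewrite count_filter; apply: eq_in_count => x xl /=.
  by case Bx: (B x) => //=; rewrite Ba ?sl.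
apply: (plane_boundP cB); rewrite ?filter_uniq //.
  by move=> x; rewrite mem_filter => /andP[_ /sl].
apply: (@leq_trans (count B l)); first by rewrite count_filter; apply: sub_count => x /andP[].
rewrite count_map count_filter.
have -> : count (predI (preim (phi w c) B) (fun x => dot u x == t)) (pts 3) =
          count (fun x => (B \o phi w c) x && (dot u x == t)) (pts 3) by [].
apply: leq_trans (count_hyperplane _ _ nu su) _.
exact/cap2/cap_phi.
Qed.

Variables (ps : seq (seq trit * seq (option (seq trit)))) (ord : seq (seq trit)).
Hypotheses (wps : all wf_partition ps) (word : all (fun x => size x == 4) ord).

(** Soundness, by induction on the certificate. A digit closes the top state by adding the bounds of
    its blocks. A letter replaces the top state by two, and each cap falls under one of them
    according to whether it contains x. *)
Lemma runP cert stack : run (map blocks ps) ord target cert stack ->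
  forall st, List.In st stack -> closes st.
Proof.
(* Codes below 48 are the line breaks inside the certificate strings; they are skipped. *)
elim: cert stack => [|c cert IH] [|[a ch] stack] //=; case: ifP => // _.
  by move=> /IH.
case: ifP => n65.
  set i := _ - _; rewrite size_map.
  move=> /andP[/andP[hi hs] /IH{}IH] st [<-|/IH //] B cB /= Ba _ _.
  apply: leq_ltn_trans hs.
  have wp := allP wps _ (mem_nth ([::], [::]) hi).
  apply: leq_trans (block_cover wp cB) _.
  rewrite sumnE big_map (nth_map ([::], [::])) // !big_seq.
  by apply: leq_sum => b hb; apply: (block_boundP wp).
set x := nth _ _ _ => /IH{}IH st [<-|h]; last by apply: IH; right; right.
have sx : size x = 4.
  rewrite /x; case: (ltnP (nat_of_ascii c - 65) (size ord)) => h.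
    by apply/eqP/(allP word); exact: mem_nth.
  by rewrite nth_default.
move=> B cB /= Ba aB sch; case Bx: (B x); last first.
  apply: (IH (remove a x, ch)) => //=; first by right; left.
  move=> y sy By; apply: lookup_remove; rewrite ?sx ?Ba //.
  by apply/eqP => yx; rewrite -yx By in Bx.
apply: (IH (foldr (restrict x) a ch, x :: ch)) => //=.
- by left.
- move=> z sz Bz; elim: ch aB sch {IH} => [|y ch IH] /=; first by rewrite Ba.
  move=> /andP[By aB] /andP[/eqP sy sch].
  rewrite /restrict; case: eqP => [_|xy]; first exact: IH.
  apply: lookup_remove; [by rewrite (@size_third 4)| |exact: IH].
  by apply/eqP => zt; apply: xy; apply: cB => //; rewrite -zt.
- by rewrite Bx.
- by rewrite sx.
Qed.

End Run.

Definition powN (p : N) (t : trit) : N :=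
  match t with T0 => 1 | T1 => p | T2 => p * p end%num.

(** The divisor of 210^2 with exponent vector x, in binary for fast evaluation; [valN_val] links it
    to [pval]. *)
Definition valN (x : seq trit) : N :=
  foldr N.mul 1%num [seq powN u.1 u.2 | u <- zip [:: 2; 3; 5; 7]%num x].

(** The letters of the certificates number the points by increasing value, starting with A for the
    divisor 1. *)
Definition ordered_pts : seq (seq trit) :=
  sort (fun x y => N.leb (valN x) (valN y)) (pts 4).

Definition partitions : seq (seq trit * seq (option (seq trit))) := [::
  ([:: T0; T0; T0; T1], [:: None; Some [:: T0; T0; T1]; Some [:: T0; T0; T1]]);
  ([:: T0; T0; T1; T1], [:: Some [:: T0; T0; T1]; Some [:: T0; T0; T1]; Some [:: T0; T1; T0]]);
  ([:: T0; T0; T1; T0], [:: None; Some [:: T0; T0; T1]; Some [:: T0; T0; T1]]);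
  ([:: T0; T1; T0; T1], [:: Some [:: T0; T0; T1]; Some [:: T0; T0; T1]; Some [:: T0; T1; T0]]);
  ([:: T0; T0; T0; T1], [:: None; Some [:: T0; T1; T0]; Some [:: T0; T0; T1]]);
  ([:: T0; T1; T1; T0], [:: Some [:: T0; T1; T0]; Some [:: T0; T1; T0]; Some [:: T0; T0; T1]]);
  ([:: T0; T1; T0; T0], [:: None; Some [:: T0; T0; T1]; Some [:: T0; T0; T1]]);
  ([:: T0; T0; T1; T0], [:: None; Some [:: T0; T1; T0]; Some [:: T0; T0; T1]]);
  ([:: T0; T1; T1; T1], [:: Some [:: T0; T0; T1]; Some [:: T0; T0; T1]; None])].

(* Triples (z, M, cert): cert proves that a cap whose points have values below
   z has at most M points. The certificates were found by a computer search. *)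
Local Open Scope string_scope.
Definition certificates : seq (N * nat * string) :=
[::
(1%num, 0%N,
"0");
(2%num, 1%N,
"0");
(3%num, 2%N,
"0");
(5%num, 3%N,
"1");
(6%num, 4%N,
"1");
(7%num, 5%N,
"1");
(10%num, 6%N,
"1");
(14%num, 7%N,
"1");
(15%num, 8%N,
"1");
(21%num, 9%N,
"1");
(25%num, 10%N,
"1");
(30%num, 11%N,
"1");
(35%num, 12%N,
"0");
(42%num, 13%N,
"0");
(60%num, 14%N,
"XWT0P0H0VE5NB115501");
(70%num, 15%N,
"0");
(105%num, 16%N,
"_`0X0PW0020");
(175%num, 17%N,
"_W`cd\0200XP0d\020Pd\020\d2eaTJ0D2F2C2M5B0A01MJ0D0F2B0A3C31HJ0D0C2F5B51JY55Y1D
Q33Q1FC5B51CB511022d\0aTM0D0F0H0J0A01MD0F0P`0X0eJ2B2[SHC03CA011002HZe550`X0I2e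
C2B112XI1eJ2cSCB0A01BA0110022HJ0A0`X0P0N2eC2B112XP0eF2D2B112PN1eD2C2FB01122DA0
`X0P0V2eB2c[JC0F01CF001002JV2P3XF0B0C012XP0eB2FC0012PV1eB2FC01122JF0PX0C3BA011
X`0ecSBC0A00CA011002`L2e^1c[CB0A01BA0110022F`X0C3AB011XP0R2ecSAC0B01CB011002R2
Pe[SCA08BA0110022ABC011100Wd\0aTM0C0A0X`0P0E2eH2F2B112Hbe550`P0E1eD2F2JB0112Pe
J2D2B1122MD0J0H0C0A01HD0J0`X0P0eC2B2FA0112XP0N2eF2B112PN1eC2c[FB0A01BA0110022D
A0`X0P0V2C3eB2JF0112XP0V2eB2[SFC0J00CJ011002PV2eB2c[JC0F00CF0110022JC0XP0F3AB0
11P`0L2ec[AF0B01FB011002`L2ecSFA08BA0110022Z1`X0P0e^1cSFC2BA001CBA0111002XP0e^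
1[SFCB0A01BA011CBA0111002Pec[CBF0A00FA011BFA01110022000");
(210%num, 18%N,
"d\V0fTH_0h00J_0Wh000F_0Wh000CW0h00_D0Q1EM018WM0A0Bh0010MJW0h_000Fh0_00CW0h_000
hH0A0DG101WD0G1c8`0P0I280HJ_0W00Fh0_W000Ch0_W000N1eB1DA1111D6JCZ04_gF016WgF316
0FhgC016_gC3160CBA61110VD1eaJ`PT1A1122FPE1M1H112Cg2`H1M112ABh3_301101efZJW]H01
40F_OM0140Ch]H0140DB311DaTMFU008FOW444B3_QH010hC084MFUh444A3_KH010WJ084HhK_000
W_004B6g^`1F2JX121664baJF4C4Q_K114KBhM010H`1_1hX0101N0hgG1810FC4QWG114GAhM010T
X1W1h`0101I0T8g1W10CK_Q114QAWT010H`1_1WX0101N0WgM8110BA3gQHT811NTI051h8T8I1G15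
3A^QTH811NTI051h8W8T5I1G1531Jh]A0140FhUB0140CK4QA010B31aTM_0h00C]W444FU_444HJ8
8hU_144_W444MJ]h444FO_444HC88_OW144Wh444HJ]W144C]h144h]W144W_444g^1664aTM_0W00
J`1P12AH3Ch0W001Ch0W00BP1X121MJW0P1`R212Fh0_00C`1X12Hh0W001HJ`1_0W00AF_0h001Ch
0`1XB1121AD6^16b1^1gZDBQ0_0hC01011660fZ1aQK2G2bJ1_1F1W1hT0101KG2bF1h1C1_1WM010
1GbJ1h1C1W1_T0101111fZ0bah_`0X0G3P0Q3K30W`0X0K3P0Q3G300_W`0X0Q3P0K3G3000040");
(294%num, 19%N,
"kAgjdaN0K0I0RT1_lH01001001VdijI0N0D1Q0WlT0100eJP`022NP12FPX022C`12B51100Ziaj0l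
1eJWhQT01000QhW100NI0B7E0F1C1`1G2KW103FIWB5101CEB511B5DP1K0G031100d\ijD7I0N0Q0
J2WX020THX1D3_0W00DM36PYX121MW0h00Ch0W00l1W0_00MDH36`RP121Hh0_00Fh0_00l1h0W00D
6HXFl101J_0W00l1_0h00l160ijWc_200I0N0_B0P0X020l^aQ`PT1122J`XH1122KXD_3012G`D51
2D1bF5C51117De^aNTM355P5F5M5E5ITH3555555eBN7`1XP127bJF^76hQ0TN111P5Q0KG550QTH3
CW001FG611FK5C0X5I5P1H15CK1I1E11^aNTI081`8T8G1I1315^aNI2E2K5J5F5C25JF1C1K5I2E1
5IE2G5X1T15EQ5`3H35555b^aQ`P522J`12KX52GX521155ajI0Q0N0Ph002l1D5eB5b^J`_002F`P
022CXT01215510iaj0`XW0h00E[h000_[h000Wh000XEc_000hc_000W_000PM_]h000hW000hcW00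
0_W000eB7\J7F7C7N5T2I5E522200Vdg0ijI0N0W`0X0eT2B2C3]1J0\3120`Ph0W00DX\I1112EcW
000Xh0_00l2\eM3C2TR11122XDP\N1112I[h000TPe33eY\8122PH\111l2\eH3CR17122Pe\T3N1J
2HY1112220g0fl0ijN0E0W_P0`0X0J3M4D\22Y3KZ13TZ30Z1Q3000NcWS`0e\322000IS`0P0Q0_X
0e\32200EQ0K0hP0`0D2_H0F0Z1X0300`PW0h00Xh0_00[S0h00Sh000XP_0h00ch_000S_000Pc[0
W00[W000D2300gd\fjc[`0X0l2000NcWS`02000IS`0F2Q0D3We3200EQ0K0_C0P0D0F0T110D3lbJ
0F01330fZQS`h0020KSPh0020GI0C2N0X_0W002JhW000FW_000Ch_000l1D0jN0I081ajN0I0KB0Q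
0_F0G1lJ0100QP_002lJ0Ch00G1R5F1T81J0hP0`0H0_b1]R16000lQ`SP5222KPJ_5512GC1Fbh10
11D1^J2F215DNWQ444IWQ244EK2G44eB5^J3X3`P13335eNI0E0FXK132JPX12Xc022Q1MX1K1G111
IE0C`G132FX`12`[322K1T`1G1Q111EJPQ132C`P12Pc322G1HP1Q1K111BbQ`F112JG15h8GC1153
b^J3X1`P13333Q`P122NcG212KPX122GI2C1`121jc[lUF080000l1D4ebNhJ010JPh102QF21IF01
T8CG00141ajN0I0h`0P0X_0020l1eJPYT1172FXYT1172C`RM1172DB51110fZ0ajN0I0h_`0P0X0C
3H4Be22R3Gl13Tl30l1Q3000NcWS`0eB032000IS`0P0B2Q0_X0l2300EQ0K0hP0`0_C0T0X0\l132
00`X_0h00Ph0_00[_h000Sh000XPW0h00cS0_00S_000PchW000[W000B2300d\flQS`h0020KSh2W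
200GOF_0010D0jF0CI0555Djh3W_3443bQG6cS`W303J0_3hj030ST3U_3h3060Kj0G6NHh306Eh_3
00Ph3F0J3W353GOM_6WI080TUe5566I0N0J0M_0h`0W3006ijW[300^NhW800JI03h8F0E0830ijN0
T3J4E4`[053^NHT566IMH566ETX136334ijN0I0W`0X0^e3220THD3W0h00CD6h0l0W00Jh0W_000X
P3F3E1D38M_0h00l1D3Fe111MFD6_0l0h00DH36`HP13l1Uh000HP13l1b^Y3J7C1166D6l1H^bJ_0
0FO00e116660fljcW7N0hP0Q2D2b]118_[b5500[ah_20000Z1^aQ`P122KPF112GC1F21D1517ZQG
2c_7F0E0hj0bW133WSb1300S`W2020KSh7WJ0H11_b5X030N0[ih2_WO1G100000GJhWj0100NhWj0
300W]6XI_0027I0hbj11j8`33D0]8_X0M0F0Yj2180Dij_Wc2000e^NWF010JI01h8W80310b_IW8S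
808WI[j0808hj0T5M510ihNW808_W8000DQWH_j05US`3100j6TOS5566_SP2744KN4_SX03X0jh00
3I4hj0G3S104GI0CJ6F6E1`1j6e11EB0N0hj0`030jh]10W00W`5X575iaj0e^NI0E0J3F11IE0J1F
33EJ1F1113100bQS`hJ05J0^55c_2W3J3]h3eN1113W2F0ePH2J3h3122KB0F0jh0W002GJ6I2ich1
aW3_Yj2180222Jh_c]10000IW_R2300_ih3aW3P0H0Yj21888Wjh00h55h]`0300KShP37WFO10M5N
3O13F0N0eB5M5C1L115OW_1]1h5P01N0hG1F0P51_H010N0[iaj0G6F0]hW01_300000GO_W8h1U1I
0X03WI[30[8X5T11I0eB5T5R5J1h155IW_[U10000NWhj0500Jh`0F0L110_ih1aW1X0M0Yj21888h
Wj01j05W`0X030iaj_cU8000e^NhW355JhF015h8F5E58BNhW155JhF085h8T8F3E585^BNhW855Jh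
F035h8`8F5E5355hNW808_W800aWNh808h_8000iajN0J4F4_X4M4P4K1H0eC1664eBQTH566NT36K
M56GT363^NIP65E`65KQ13QPC1133IEX65JF33F`G1333EQG13G`F11333QTH366KH565^QK2G2W5I
0_55NKP525KIG255GW5515jN0J4E4`5T3Q5P33eB3^NTI036IE03335ajN0I0J4F48eB3^NTI036IE
033354iajN0I0_X0P0D2T2C2RY2L^e0`B0022220l^Q`P122J`WH1152KF21GF21b5DZF5C51157eB
THIP121PIJ111X`127M`NC111PX127HXEF111`C117bZh1Q6J0FC01166^JF7C7HI1`12MW1X1E7`N
h01121FC7ME1P12T_1`1N7PIh01121CTN1X12Hh1P1I7XE_01121DZQHT311NTI081T8P8I1K3351T
M_1P1`12JYP777HCR211PYX177X`777MCR`177HJR211`RP177PX777HFYJ111XL`177`P777b16^`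
XH3M71PM3T712XPT3H71227jN0I0_X0P020l1eB7^J`R172F`M112CTH111171ajN0I0h`0P0T2l2D
2Q2F0H0C2B510l1eB7^J`R172F`M112CTH1111710flZ0aW\QcP030KSN030hG88_J8801h_X0O1`0
c[UF03077000ZiheQS`030GcN030WK88_C8801_WX0O1`0P0K3Q7UG7F030000biaj_]UcSX064444
0^NI0E0KWQ330QBh`030PM3W3hT0303J4heX8334IE0QWK330KD_X030PM3W3_T0303J4_eG3834EQ
hG330GB_X030`H3h3_T0303F4`8hP334DB1eQP`833J`F053`8_8G3F351B\Q`P833J`F053h8`8F3
G3513QK6G6I3W3E3h3_`010KG6N3W3E3_3hX010GN3h3I3_3W`0103h^QE03P3`3NS3033_W`0P0DQ
30300aW^QI03`3P3Nc3033h_`0G3X0O6U64000iaj4^NI0E0h`3X334IE0_X3`334Eh`3P334DB133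
344iaj0`Xh0_00Nc_000EcW000c_W000W0_00XI[h000E[W000[hW000W0h00PNcW000ISh000Sh_0
00h0_00l2\D7eB332200d\V0fl0ijN0E0Q0K0WJ0C0A0`0X0T2D2B2]1H0M310TH_0h00J_0Wh000F
_0Wh000CW0h00_D0Q1EM018WM0A0Bh0010MJW0h_000Fh0_00CW0h_000hH0A0DG101WD0G1c8`0P0
I280HJ_0W00Fh0_W000Ch0_W000N1eB1DA1111D6JCZ04_gF016WgF3160FhgC016_gC3160CBA611
100Viaj0D1eJ`PT1B1122FPE1B1H112Cg2`H1M112BAh3_3011100flZ0aWeJOM014K1G1_Q18hM0T
0101h_S2[20000ZiheCUT014Q1G1_K18WT0M0101_WS2c20000Diaj4Q_Wc`02044K_h[`02004GhW
cP02000044biaj_c[UOH0200000eJF4C4Q_K114KBhM010H`1_1hX0101N0hgG1810FC4QWG114GAh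
M010TX1W1h`0101I0T8g1W10CK_Q114QAWT010H`1_1WX0101N0WgM8110BA3gQHT811NTI051h8T8
I1G153A^QTH811NTI051h8W8T5I1G1531QK2G2J1_1F1W1hT010KG2F1h1C1_1WM010GJ1h1C1W1_T
0101heKF41H0M0J]0011_WT0Q1S2c2000aWeQF41H0T0C]0011h_T4M0AG101000iaj4QKB0A0HN1e
Sh`W002W`020011cW_3hP224_hX22444K[h_3WX224_WP22444Gec[`0_2hW200001044iaj0eTMX1
P12J`1P12FX1P`122CX1`D112H`1X121MJP1`X122FP1X`122CBNX1211H`1P121HJ`1XP122FBYP1
211CBh0W0011BA6b1gZDQ0_0hC010166Ab1l^DQ0W0hC0101661100fl0Z0biaj0h_`0X0G3P0Q3K3
0W`0X0K3P0Q3G300_W`0X0Q3P0K3G30000040")].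

Local Close Scope string_scope.

Definition initial_state (z : N) : state :=
  (build 4 (fun x => N.ltb (valN x) z), [::]).

Lemma certificates_ok :
  let parts := map blocks partitions in
  let ord := ordered_pts in
  all (fun c => run parts ord c.1.2.+1 c.2 [:: initial_state c.1.1]) certificates.
Proof. by vm_compute. Qed.

Lemma cap_below z M cert B : List.In (z, M, cert) certificates -> cap 4 B ->
  (forall x, size x = 4 -> B x -> N.ltb (valN x) z) -> count B (pts 4) <= M.
Proof.
have all_In (T : Type) (P : pred T) s c : all P s -> List.In c s -> P c.
  by elim: s => //= d s IH /andP[Pd /IH Ps] [<-|/Ps].
move=> /(all_In _ _ _ _ certificates_ok) hr cB Bz; rewrite -ltnS.
have wp : all wf_partition partitions by vm_compute.
have wo : all (fun x => size x == 4) ordered_pts.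
  by apply/allP => x; rewrite mem_sort mem_pts.
apply: (runP wp wo hr (or_introl erefl)) => // x sx Bx.
by have -> := lookup_build (fun x => N.ltb (valN x) z) sx; exact: Bz.
Qed.

(** * Sets without nontrivial solutions *)

Definition good (A : pred nat) : Prop := forall a b c x,
  A a -> A b -> A c -> a * b * c = x ^ 3 -> a = b /\ b = c.

(** Covers both [fmax 3 3 n], by [fmax33E], and the function F of the outline, which is
    [maxgood_smooth W]. *)
Definition maxgood (N : nat) (D : pred nat) : nat :=
  \max_(A : {set 'I_N.+1} | [forall a in A, D (val a)] &&
      `[< good (fun m => m \in [seq val a | a in A]) >]) #|A|.

Lemma maxgood_ge N (D : pred nat) (s : seq nat) : uniq s ->
  (forall m, m \in s -> m <= N /\ D m) -> good (fun m => m \in s) ->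
  size s <= maxgood N D.
Proof.
move=> us sD gs; pose A := [set i : 'I_N.+1 | val i \in s].
have mA m : (m \in [seq val a | a in A]) = (m \in s).
  apply/imageP/idP => [[a]|ms]; first by rewrite inE => ? ->.
  have [mN _] := sD _ ms.
  by exists (Ordinal (mN : m < N.+1)); rewrite ?inE.
have sA : size s <= #|A|.
  by rewrite -(size_image val A); apply: uniq_leq_size => // m; rewrite mA.
apply: leq_trans sA _; apply: leq_bigmax_cond; apply/andP; split.
  by apply/forall_inP => a; rewrite inE => /sD[].
apply/asboolP => a b c x; rewrite !mA; exact: gs.
Qed.

Lemma maxgood_ex N (D : pred nat) : exists s : seq nat,
  [/\ uniq s, forall m, m \in s -> m <= N /\ D m, good (fun m => m \in s) &
      size s = maxgood N D].
Proof.
pose P (A : {set 'I_N.+1}) := [forall a in A, D (val a)] &&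
      `[< good (fun m => m \in [seq val a | a in A]) >].
have P0 : 0 < #|P|.
  apply/card_gt0P; exists set0; rewrite unfold_in; apply/andP; split.
    by apply/forall_inP => a; rewrite inE.
  by apply/asboolP => a b c x /imageP[?]; rewrite inE.
have [A /andP[/forall_inP DA /asboolP gA] eqA] :=
  eq_bigmax_cond (fun A : {set 'I_N.+1} => #|A|) P0.
exists [seq val a | a in A]; split => //.
- by rewrite map_inj_uniq ?enum_uniq //; exact: val_inj.
- by move=> m /imageP[a aA ->]; rewrite DA // -ltnS ltn_ord.
by rewrite size_image -eqA.
Qed.

(** A block with three elements in a partition of 'I_3 is the whole index set. *)
Lemma trivial_solution33 (a : 'I_3 -> nat) :
  trivial_solution 3 a <-> (forall i j, a i = a j).
Proof.
split=> [[P [pP hP]] i j|h].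
  have [iP jP] : i \in cover P /\ j \in cover P by rewrite (cover_partition pP) !inE.
  have [cB eB] := hP _ (pblock_mem iP).
  have BT : pblock P i = [set: 'I_3].
    by apply/eqP; rewrite eqEcard subsetT cB cardsT card_ord.
  by apply: eB; rewrite BT inE.
exists [set [set: 'I_3]]; split.
  apply/and3P; split; first by rewrite /cover big_set1.
    by apply/trivIsetP => A B /set1P -> /set1P ->; rewrite eqxx.
  rewrite inE eq_sym -cards_eq0 cardsT card_ord //.
by move=> B /set1P ->; rewrite cardsT card_ord.
Qed.

Lemma fmax33E n : fmax 3 3 n = maxgood n (fun m => 0 < m).
Proof.
apply: eq_bigl => A; congr (_ && _).
  apply/idP/forall_inP => [h a aA|h].
    rewrite lt0n; apply: contra h => /eqP a0.
    by rewrite (_ : ord0 = a) //; apply/val_inj.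
  by apply/negP => /h.
apply/asboolP/asboolP => h.
  move=> a b c x /imageP[i iA ->] /imageP[j jA ->] /imageP[l lA ->] e.
  pose f (u : 'I_3) := nth i [:: i; j; l] u.
  have /trivial_solution33 t : trivial_solution 3 (fun u => f u : nat).
    apply: (h f (Posz x)).
      by move=> u; rewrite /f; case: u => -[|[|[|]]].
    by rewrite 3!big_ord_recl big_ord0 /f /= muln1 mulnA e expnS -mulnn !PoszM.
  have := t ord0 (@Ordinal 3 1 isT); have := t (@Ordinal 3 1 isT) (@Ordinal 3 2 isT).
  by rewrite /f.
move=> a x aA e; apply/trivial_solution33.
have m i : val (a i) \in [seq val a | a in A] by apply: map_f; rewrite mem_enum.
(* The product is a natural number, so the integer x may be replaced by its absolute value. *)
have := h _ _ _ `|x|%N (m ord0) (m (lift ord0 ord0)) (m (lift ord0 (lift ord0 ord0))).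
case=> [|h1 h2].
  move: e; rewrite 3!big_ord_recl big_ord0 muln1 mulnA => /(congr1 absz) /=.
  by rewrite abszX.
have h3 i : a i = a ord0 :> nat.
  case: i => -[|[|[|i]]] hi //.
  - by congr (val (a _)); apply: val_inj.
  - by rewrite h1; congr (val (a _)); apply: val_inj.
  - by rewrite h1 h2; congr (val (a _)); apply: val_inj.
by move=> i j; rewrite !h3.
Qed.

(** * The upper bound S(n): rough and smooth parts *)

Definition maxgood_smooth (W z : nat) : nat :=
  maxgood (W ^ 2) (fun d => (d %| W ^ 2) && (d <= z)).

(** If s does not divide W^2, some prime p of W has exponent at least 3 in s, because p^2 divides
    W^2. Splitting off p^3 gives a smaller s. *)
Lemma cube_decomp W s : 0 < W -> \pi(W).-nat s ->
  exists k q, s = q * k ^ 3 /\ q %| W ^ 2.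
Proof.
move=> W0; elim/ltn_ind: s => s IH ps.
have s0 : 0 < s by case/andP: ps.
case: (boolP (s %| W ^ 2)) => [sW|]; first by exists 1, s; rewrite muln1.
move/dvdn_partP => /(_ s0) nd.
have [p ps' np] : exists2 p, p \in \pi(s) & ~~ (s`_p %| W ^ 2).
  apply/not_exists2P => h; apply: nd => p hp.
  by case: (h p) => // /negP; rewrite negbK.
have pW : p \in \pi(W) by apply: (pnatP _ s0 ps) => //; move: ps'; rewrite mem_primes => /and3P[].
have [pp pdW] : prime p /\ p %| W by move: pW; rewrite mem_primes => /and3P[].
have l3 : 3 <= logn p s.
  rewrite leqNgt; apply: contra np => l2; rewrite p_part.
  apply: dvdn_trans (dvdn_exp2r 2 pdW); exact: dvdn_exp2l.
have d3 : p ^ 3 %| s by apply: dvdn_trans (pfactor_dvdnn p s); exact: dvdn_exp2l.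
have p30 : 1 < p ^ 3 by rewrite -(exp1n 3) ltn_exp2r // prime_gt1.
have [||k [q [sE qW]]] := IH (s %/ p ^ 3).
- by rewrite ltn_Pdiv.
- by apply: pnat_dvd ps; rewrite dvdn_div // ltnW.
exists (k * p), q; split=> //.
by rewrite -(divnK d3) sE expnMn mulnA.
Qed.

Lemma smooth_rough_decomp W m : 0 < W -> 0 < m -> exists t q k,
  [/\ m = t * q * k ^ 3, coprime t W & q %| W ^ 2].
Proof.
move=> W0 m0; have [k [q [e qW]]] := cube_decomp W0 (part_pnat \pi(W) m).
exists (m`_\pi(W)^'), q, k; split=> //.
  by rewrite -mulnA -e mulnC partnC.
by rewrite coprime_sym coprime_pi' ?part_gt0 // part_pnat.
Qed.

(** An optimal set is sorted by the rough part t. For fixed t the map from m to its part q is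
    injective with an admissible image, because the factors t contribute the cube t^3. *)
Lemma fmax_upper W n : 0 < W ->
  fmax 3 3 n <= \sum_(t <- iota 1 n | coprime t W) maxgood_smooth W (n %/ t).
Proof.
move=> W0; rewrite fmax33E.
have [A [uA nA gA <-]] := maxgood_ex n (fun m => 0 < m).
have /choice[f fP] m : exists v : nat * nat * nat, 0 < m ->
    [/\ m = v.1.1 * v.1.2 * v.2 ^ 3, coprime v.1.1 W & v.1.2 %| W ^ 2].
  case: (posnP m) => [->|m0]; first by exists (0, 0, 0).
  by have [t [q [k h]]] := smooth_rough_decomp W0 m0; exists (t, q, k).
have fA m : m \in A -> [/\ m <= n, m = (f m).1.1 * (f m).1.2 * (f m).2 ^ 3,
    coprime (f m).1.1 W, (f m).1.2 %| W ^ 2 &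
    [/\ 0 < (f m).1.1, 0 < (f m).1.2 & 0 < (f m).2]].
  move=> /nA[mn m0]; have [e c d] := fP m m0; split => //.
  move: m0; rewrite {1}e muln_gt0 expn_gt0 orbF => /andP[].
  by rewrite muln_gt0 => /andP[-> ->] ->.
have -> : size A = \sum_(t <- iota 1 n | coprime t W) count (fun m => (f m).1.1 == t) A.
  rewrite -big_filter sum_count -sum1_size !big_seq; apply: eq_bigr => m mA.
  have [mn e cW _ [t0 q0 k0]] := fA m mA.
  rewrite (eq_count (a2 := pred1 (f m).1.1)); last by move=> t; rewrite /= eq_sym.
  rewrite count_uniq_mem ?filter_uniq ?iota_uniq // mem_filter cW mem_iota t0 add1n ltnS.
  suff -> : (f m).1.1 <= n by [].
  by apply: leq_trans mn; rewrite {2}e -mulnA leq_pmulr // muln_gt0 q0 expn_gt0 k0.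
apply: leq_sum => t tW; rewrite -size_filter -(size_map (fun m => (f m).1.2)).
have mf m : m \in filter (fun m => (f m).1.1 == t) A -> m \in A /\ (f m).1.1 = t.
  by rewrite mem_filter => /andP[/eqP].
apply: maxgood_ge.
- rewrite map_inj_in_uniq ?filter_uniq // => m1 m2 /mf[m1A t1] /mf[m2A t2] eq.
  have [_ e1 _ _ _] := fA _ m1A; have [_ e2 _ _ _] := fA _ m2A.
  (* Two elements with the same t and q differ by a rational cube, so m1 * m1 * m2 is a cube. *)
  have [|_ //] := gA m1 m1 m2 (t * (f m1).1.2 * (f m1).2 ^ 2 * (f m2).2) m1A m1A m2A.
  move: e1 e2; rewrite t1 t2 -eq; move: (f m1).1.2 (f m1).2 (f m2).2 => q k1 k2.
  by move=> -> ->; ring.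
- move=> q /mapP[m /mf[mA mt] ->]; have [mn e _ d [t0 q0 k0]] := fA _ mA.
  rewrite d dvdn_leq ?expn_gt0 ?W0 //=; split=> //.
  rewrite leq_divRL -?mt //; apply: leq_trans mn; rewrite {3}e mulnC.
  by rewrite leq_pmulr // expn_gt0 k0.
move=> q1 q2 q3 x /mapP[m1 /mf[A1 t1] ->] /mapP[m2 /mf[A2 t2] ->].
move=> /mapP[m3 /mf[A3 t3] ->] e.
have [_ e1 _ _ _] := fA _ A1; have [_ e2 _ _ _] := fA _ A2; have [_ e3 _ _ _] := fA _ A3.
have [|-> ->//] := gA m1 m2 m3 (t * x * (f m1).2 * (f m2).2 * (f m3).2) A1 A2 A3.
move: e1 e2 e3 e; rewrite t1 t2 t3.
move: (f m1).1.2 (f m2).1.2 (f m3).1.2 (f m1).2 (f m2).2 (f m3).2.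
move=> q1' q2' q3' k1 k2 k3 -> -> -> e.
transitivity (t ^ 3 * (q1' * q2' * q3') * (k1 * k2 * k3) ^ 3); first by ring.
by rewrite e; ring.
Qed.

(** * The lower bound: gluing admissible sets of divisors *)

Definition squarefree (t : nat) : bool := all (fun p => ~~ (p ^ 2 %| t)) (primes t).

Lemma partn_smooth_rough W t q : 0 < W -> 0 < t -> coprime t W -> q %| W ^ 2 ->
  (t * q)`_\pi(W) = q /\ (t * q)`_\pi(W)^' = t.
Proof.
move=> W0 t0 tW qW.
have q0 : 0 < q by apply: dvdn_gt0 qW; rewrite expn_gt0 W0.
have pt : \pi(W)^'.-nat t by rewrite -coprime_pi' // coprime_sym.
have pq : \pi(W).-nat q by apply: pnat_dvd qW _; rewrite pnatX pnat_pi.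
rewrite !partnM // (part_pnat_id pq) (part_pnat_id pt).
by rewrite part_p'nat // part_p'nat ?muln1 ?mul1n // pnatNK.
Qed.

(** At each prime the three exponents are 0 or 1 and their sum is a multiple of 3, so they agree. *)
Lemma squarefree_cube a b c x : 0 < a -> 0 < b -> 0 < c ->
  squarefree a -> squarefree b -> squarefree c -> a * b * c = x ^ 3 ->
  a = b /\ b = c.
Proof.
move=> a0 b0 c0 sa sb sc e.
have l1 m p : 0 < m -> squarefree m -> logn p m <= 1.
  move=> m0 /allP h; rewrite leqNgt; apply/negP => l2.
  have pm : p \in primes m by rewrite -logn_gt0 ltnW.
  have := h p pm; rewrite pfactor_dvdn ?l2 //.
  by move: pm; rewrite mem_primes => /andP[].
have le p : logn p a + logn p b + logn p c = 3 * logn p x.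
  by rewrite -lognX -e !lognM ?muln_gt0 ?a0.
by split; apply: eqn_from_log => // p; have := le p;
  have := l1 a p a0 sa; have := l1 b p b0 sb; have := l1 c p c0 sc; lia.
Qed.

Section Products.

Variables (W n : nat) (C : nat -> seq nat) (Q : pred nat).
Hypotheses (W0 : 0 < W) (uC : forall z, uniq (C z)).
Hypothesis C_le : forall z q, q \in C z -> q %| W ^ 2 /\ q <= z.
Hypothesis QW : forall t, Q t -> coprime t W.

Let r := [seq t <- iota 1 n | Q t].
Let L := [seq t * q | t <- r, q <- C (n %/ t)].

Let rP t : t \in r -> [/\ 0 < t, t <= n, coprime t W & Q t].
Proof. by rewrite mem_filter mem_iota add1n ltnS => /andP[Qt /andP[-> ->]]; rewrite QW. Qed.

Lemma products_uniq : uniq L.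
Proof.
apply: allpairs_uniq_dep => [|t _|]; rewrite ?filter_uniq ?iota_uniq //.
move=> [t q] [t' q'] /allpairsPdep[u [v [/rP[u0 _ uW _] /C_le[vW _] ->]]].
move=> /allpairsPdep[u' [v' [/rP[u0' _ uW' _] /C_le[vW' _] ->]]] /= e.
have [h1 h2] := partn_smooth_rough W0 u0 uW vW.
have [h3 h4] := partn_smooth_rough W0 u0' uW' vW'.
have [-> ->] // : u = u' /\ v = v' by move: h1 h2; rewrite e h3 h4 => -> ->.
Qed.

Lemma products_le m : m \in L -> 0 < m <= n.
Proof.
move=> /allpairsPdep[t [q [/rP[t0 tn _ _] /C_le[qW qn] ->]]].
rewrite muln_gt0 t0 (dvdn_gt0 _ qW) ?expn_gt0 ?W0 //=.
by rewrite mulnC -leq_divRL.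
Qed.

Lemma size_products : size L = \sum_(t <- iota 1 n | Q t) size (C (n %/ t)).
Proof. by rewrite size_allpairs_dep sumnE big_map big_filter. Qed.

(** With Q the coprimality to W this becomes S(n) <= n, which controls the loss from large primes in
    [large_loss]. *)
Lemma size_products_le : \sum_(t <- iota 1 n | Q t) size (C (n %/ t)) <= n.
Proof.
rewrite -size_products -[X in _ <= X](size_iota 1); apply: uniq_leq_size.
  exact: products_uniq.
by move=> m /products_le; rewrite mem_iota add1n ltnS.
Qed.

(** A solution splits into its parts prime to W and supported on W, each with a cube as product. The
    first makes the three t equal, and then the second is a solution inside a single C (n / t). *)
Lemma fmax_lower : (forall t, Q t -> squarefree t) ->
  (forall z, good (fun q => q \in C z)) ->
  \sum_(t <- iota 1 n | Q t) size (C (n %/ t)) <= fmax 3 3 n.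
Proof.
move=> sfQ gC; rewrite fmax33E -size_products; apply: maxgood_ge.
- exact: products_uniq.
- by move=> m /products_le/andP[].
move=> a b c x /allpairsPdep[t [q [/rP[t0 _ tW tQ] qC ->]]].
move=> /allpairsPdep[t' [q' [/rP[t0' _ tW' tQ'] qC' ->]]].
move=> /allpairsPdep[t2 [q2 [/rP[t02 _ tW2 tQ2] qC2 ->]]] e.
have [[d1 _] [d2 _] [d3 _]] := And3 (C_le qC) (C_le qC') (C_le qC2).
have W2 : 0 < W ^ 2 by rewrite expn_gt0 W0.
have [[p1 p1'] [p2 p2'] [p3 p3']] := And3 (partn_smooth_rough W0 t0 tW d1)
  (partn_smooth_rough W0 t0' tW' d2) (partn_smooth_rough W0 t02 tW2 d3).
have pos : [/\ 0 < t * q, 0 < t' * q' & 0 < t2 * q2].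
  by split; rewrite muln_gt0 ?t0 ?t0' ?t02 (dvdn_gt0 W2).
case: pos => m1 m2 m3.
have part (pi : nat_pred) : (t * q)`_pi * (t' * q')`_pi * (t2 * q2)`_pi = x`_pi ^ 3.
  have m12 : 0 < t * q * (t' * q') by rewrite muln_gt0 m1 m2.
  by rewrite -partnX -e (partnM pi m12 m3) (partnM pi m1 m2).
have [tt' tt2] : t = t' /\ t' = t2.
  apply: (@squarefree_cube _ _ _ x`_\pi(W)^') => //; rewrite ?sfQ //.
  by rewrite -part p1' p2' p3'.
subst t' t2; have [] := gC _ _ _ _ x`_\pi(W) qC qC' qC2; last by move=> -> ->.
by rewrite -part p1 p2 p3.
Qed.

End Products.

Lemma sum_multiples n d (P : pred nat) (G : nat -> nat) : 0 < d ->
  \sum_(t <- iota 1 n | P t && (d %| t)) G t =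
  \sum_(u <- iota 1 (n %/ d) | P (d * u)) G (d * u).
Proof.
move=> d0; transitivity (\sum_(t <- [seq d * u | u <- iota 1 (n %/ d)] | P t) G t).
  rewrite big_mkcondr -big_mkcondl /= [LHS](eq_bigl (fun t => (d %| t) && P t)); last first.
    by move=> t; rewrite andbC.
  rewrite -big_filter_cond; apply: perm_big; apply: uniq_perm.
  - by rewrite filter_uniq ?iota_uniq.
  - by rewrite map_inj_uniq ?iota_uniq // => x y /eqP; rewrite eqn_pmul2l // => /eqP.
  move=> t; rewrite mem_filter mem_iota add1n ltnS; apply/idP/mapP.
    move=> /andP[/dvdnP[u ->]]; rewrite muln_gt0 => /andP[/andP[u0 _] un].
    by exists u; rewrite 1?mulnC // mem_iota u0 add1n ltnS leq_divRL.
  move=> [u]; rewrite mem_iota add1n ltnS leq_divRL // => /andP[u0 un] ->.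
  by rewrite dvdn_mulr // muln_gt0 d0 u0 mulnC.
by rewrite big_map.
Qed.

(** A union bound: if t is coprime to W and not squarefree, then t = p^2 u for a prime p not
    dividing W, and n / t is the quotient of n / p^2 by u. *)
Lemma squarefree_loss W n (g : nat -> nat) : 0 < W ->
  \sum_(t <- iota 1 n | coprime t W) g (n %/ t) <=
  \sum_(t <- iota 1 n | coprime t W && squarefree t) g (n %/ t) +
  \sum_(p <- iota 1 n | prime p && ~~ (p %| W))
    \sum_(u <- iota 1 (n %/ p ^ 2) | coprime u W) g (n %/ p ^ 2 %/ u).
Proof.
move=> W0; rewrite (bigID squarefree) /= leq_add2l.
have h p : prime p && ~~ (p %| W) ->
    \sum_(t <- iota 1 n | coprime t W && (p ^ 2 %| t)) g (n %/ t) =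
    \sum_(u <- iota 1 (n %/ p ^ 2) | coprime u W) g (n %/ p ^ 2 %/ u).
  move=> /andP[pp pW]; rewrite sum_multiples ?expn_gt0 ?prime_gt0 //.
  apply: eq_big => [u|u _]; last by rewrite divnMA.
  by rewrite coprimeMl coprimeXl // prime_coprime.
rewrite -(eq_bigr _ h).
under [X in _ <= X]eq_bigr => p _ do rewrite big_mkcond.
rewrite exchange_big /= big_mkcond !big_seq; apply: leq_sum => t.
rewrite mem_iota add1n ltnS => /andP[t0 tn]; case: ifP => // /andP[tW].
move=> /allPn[p]; rewrite mem_primes => /and3P[pp _ pt]; rewrite negbK => p2.
have pW : ~~ (p %| W).
  apply: contraL tW => pW; rewrite /coprime -dvdn1; apply/negP => d1.
  have : p %| gcdn t W by rewrite dvdn_gcd pt.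
  by move=> /dvdn_trans/(_ d1); rewrite dvdn1 => /eqP p1; rewrite p1 in pp.
rewrite (big_rem p) /=; last first.
  by rewrite mem_iota prime_gt0 // add1n ltnS (leq_trans (dvdn_leq t0 pt)).
by rewrite pp pW tW p2 leq_addr.
Qed.

(** * Step functions summed over the numbers coprime to W *)

Definition step (zs : seq nat) (z : nat) : nat := count (fun j => j <= z) zs.

Definition rough (W m : nat) : nat := count (fun t => coprime t W) (iota 1 m).

(** Exchanges the sums: the jump j is counted at n / t exactly when t <= n / j. *)
Lemma sum_step W n zs : all (leq 1) zs ->
  \sum_(t <- iota 1 n | coprime t W) step zs (n %/ t) =
  \sum_(j <- zs) rough W (n %/ j).
Proof.
move=> /allP zs1; rewrite -big_filter sum_count !big_seq; apply: eq_bigr => j jz.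
have j1 := zs1 j jz; rewrite count_filter /rough.
have -> : iota 1 n = iota 1 (n %/ j) ++ iota (1 + n %/ j) (n - n %/ j).
  by rewrite -iotaD subnKC // leq_div.
rewrite count_cat -[RHS]addn0; congr addn.
  apply: eq_in_count => t /=; rewrite mem_iota add1n ltnS => /andP[t0 tn].
  by rewrite leq_divRL // mulnC -leq_divRL // tn.
apply/eqP; rewrite -leqn0 leqNgt -has_count; apply/hasPn => t.
rewrite mem_iota add1n => /andP[t0 _]; have tp := leq_ltn_trans (leq0n _) t0.
by rewrite negb_and leq_divRL // mulnC -leq_divRL // -ltnNge t0.
Qed.

Lemma rough_period W a : 0 < W -> rough W (a * W) = a * totient W.
Proof.
move=> W0; elim: a => // a IH.
rewrite !mulSn [W + _]addnC /rough iotaD count_cat -/(rough _ _) IH addnC; congr addn.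
rewrite totient_count_coprime -sum1_count big_mkcond /=.
rewrite -[_ + a * W]/(1 + a * W) addnC iotaDl big_map.
transitivity (\sum_(i <- iota 1 W) nat_of_bool (coprime W i)).
  apply: eq_bigr => i _; rewrite coprime_sym /coprime gcdnMDl.
  by case: (_ == 1).
(* The two ranges 1..W and 0..W - 1 differ in W and 0, which have the same gcd with W. *)
rewrite /index_iota subn0 -[W in iota 1 W](prednK W0) -[W in iota 0 W](prednK W0).
rewrite -[W.-1.+1 in LHS]addn1 iotaD big_cat /= big_seq1 [RHS]big_cons.
by rewrite add1n (prednK W0) /coprime gcdnn gcdn0 addnC.
Qed.

Lemma rough_bounds W m : 0 < W ->
  (m %/ W) * totient W <= rough W m <= (m %/ W).+1 * totient W.
Proof.
move=> W0; rewrite -!rough_period //.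
have mono a b : a <= b -> rough W a <= rough W b.
  by move=> ab; rewrite /rough -(subnKC ab) iotaD count_cat leq_addr.
rewrite !mono ?leq_trunc_div //.
by rewrite ltnW // ltn_ceil.
Qed.

(** * Caps among the divisors of 210^2 *)

Lemma uniq_map_inj (S T : eqType) (f : S -> T) (s : seq S) :
  uniq (map f s) -> {in s &, injective f}.
Proof.
elim: s => //= z s IH /andP[fz us] x y; rewrite !inE.
case/predU1P => [->|xs] /predU1P[->|ys] // e.
- by case/negP: fz; rewrite e map_f.
- by case/negP: fz; rewrite -e map_f.
exact: IH.
Qed.

Lemma dvdn_mulP d a b : 0 < d -> d %| a * b -> exists d1 d2,
  [/\ d = d1 * d2, d1 %| a & d2 %| b].
Proof.
move=> d0 dab; exists (gcdn d a), (d %/ gcdn d a).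
have g0 : 0 < gcdn d a by rewrite gcdn_gt0 d0.
rewrite mulnC divnK ?dvdn_gcdl ?dvdn_gcdr //; split=> //.
have [[d' dE] [a' aE]] := (dvdnP (dvdn_gcdl d a), dvdnP (dvdn_gcdr d a)).
set g := gcdn d a in g0 dE aE *.
have -> : d %/ g = d' by rewrite {1}dE mulnK.
have : d' * g %| a' * g * b by rewrite -dE -aE.
rewrite mulnAC dvdn_pmul2r // Gauss_dvdr //.
have : gcdn (d' * g) (a' * g) = g by rewrite -dE -aE.
by rewrite -muln_gcdl => /eqP; rewrite -[X in _ == X]mul1n eqn_pmul2r.
Qed.

Definition exps (t : trit) : nat := match t with T0 => 0 | T1 => 1 | T2 => 2 end.

Definition pval (ps : seq nat) (x : seq trit) : nat :=
  \prod_(u <- zip ps x) u.1 ^ exps u.2.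

Lemma val_surj ps d : all prime ps -> d %| (\prod_(p <- ps) p) ^ 2 ->
  exists2 x, size x = size ps & d = pval ps x.
Proof.
elim: ps d => [|p ps IH] d /=.
  by move=> _; rewrite big_nil dvdn1 => /eqP ->; exists [::]; rewrite // /pval big_nil.
move=> /andP[pp pps]; rewrite big_cons expnMn => h.
have [|d1 [d2 [-> h1 h2]]] := dvdn_mulP _ h.
  apply: dvdn_gt0 h; rewrite -expnMn expn_gt0 muln_gt0 prime_gt0 //=.
  rewrite orbF big_seq; apply: prodn_cond_gt0 => q /(allP pps); exact: prime_gt0.
have [x sx ->] := IH d2 pps h2.
have [m m2 ->] : exists2 m, m <= 2 & d1 = p ^ m by apply/dvdn_pfactor.
exists (nth T0 trits m :: x); first by rewrite /= sx.
by rewrite /pval /= big_cons; congr (_ * _); case: m m2 => [|[|[|]]].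
Qed.

(** At each prime the three exponents add up to 0, 3 or 6. *)
Lemma val_third ps x y : size x = size ps -> size y = size ps ->
  exists z, pval ps x * pval ps y * pval ps (third x y) = z ^ 3.
Proof.
rewrite /pval; elim: ps x y => [|p ps IH] [|a x] [|b y] //=.
  by exists 1; rewrite !big_nil.
move=> [/IH{}IH] [/IH[z e]]; rewrite !big_cons /=.
have [k kE] : exists k, p ^ exps a * p ^ exps b * p ^ exps (tthird a b) = (p ^ k) ^ 3.
  rewrite -!expnD; case: a; case: b => /=; [exists 0|exists 1|exists 1|exists 1|exists 1|
    exists 1|exists 1|exists 1|exists 2]; by rewrite -expnM.
exists (p ^ k * z); rewrite expnMn -e -kE; ring.
Qed.

Lemma valN_val x : size x = 4 -> N.to_nat (valN x) = pval [:: 2; 3; 5; 7] x.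
Proof.
case: x => [|a [|b [|c [|d [|]]]]] // _.
rewrite /valN /pval /= !N2Nat.inj_mul !big_cons big_nil /=.
by case: a; case: b; case: c; case: d.
Qed.

Lemma good_cap (s : seq nat) : good (fun m => m \in s) ->
  cap 4 (fun x => pval [:: 2; 3; 5; 7] x \in s).
Proof.
move=> gs x y sx sy xs ys ts.
have [z e] := @val_third [:: 2; 3; 5; 7] x y sx sy.
have [eq _] := gs _ _ _ z xs ys ts e.
have := eq; rewrite -!valN_val //.
move=> /(congr1 N.of_nat); rewrite !N2Nat.id => eN.
have /uniq_map_inj : uniq (map valN (pts 4)) by vm_compute.
by apply; rewrite ?mem_pts ?sx ?sy.
Qed.

(** With k = [step zs z], the jump of index k, if there is one, exceeds z since zs is sorted; the
    assumption for i = k then applies. *)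
Lemma step_stair (zs : seq nat) (F : nat -> nat) : sorted leq zs ->
  (forall i z, i < size zs -> z < nth 0 zs i -> F z <= i) ->
  (forall z, F z <= size zs) -> forall z, F z <= step zs z.
Proof.
move=> so hF hs z; have := count_size (fun j => j <= z) zs; rewrite -/(step zs z).
rewrite leq_eqVlt => /predU1P[->//|kn].
apply: hF => //; rewrite ltnNge; apply/negP => kz.
set k := (step zs z).+1 in kn.
have e : step zs z = count (fun j => j <= z) (take k zs) + count (fun j => j <= z) (drop k zs).
  by rewrite -count_cat cat_take_drop.
suff : all (fun j => j <= z) (take k zs).
  by rewrite all_count => /eqP h; move: e; rewrite h size_takel // /k; lia.
apply/(all_nthP 0) => i; rewrite size_takel // => ik; rewrite nth_take //.
apply: leq_trans kz; apply: (sorted_leq_nth leq_trans leqnn) => //.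
by rewrite inE (leq_trans ik).
Qed.

(* The last jump of maxgood_smooth 210 is at 315; the bound 294 is good enough
   and cheaper to certify. *)
Definition zs210 : seq nat :=
  [:: 1; 2; 3; 5; 6; 7; 10; 14; 15; 21; 25; 30; 35; 42; 60; 70; 105; 175; 210; 294].

(** The exponent vectors of an admissible set of divisors form a cap in F_3^4. The i-th certificate
    bounds it by i below the i-th jump, and [cap4] gives 20, the number of jumps, everywhere. *)
Lemma maxgood_smooth210 z : maxgood_smooth 210 z <= step zs210 z.
Proof.
pose ps := [:: 2; 3; 5; 7].
have W210 : 210 = \prod_(p <- ps) p by rewrite unlock.
have key y : exists B, [/\ cap 4 B, maxgood_smooth 210 y <= count B (pts 4) &
    forall x, size x = 4 -> B x -> pval ps x <= y].
  have [s [us sD gs sE]] := maxgood_ex (210 ^ 2) (fun d => (d %| 210 ^ 2) && (d <= y)).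
  rewrite /maxgood_smooth -sE.
  exists (fun x => pval ps x \in s); split; first exact: good_cap.
    rewrite -size_filter -(size_map (pval ps)); apply: uniq_leq_size => // d ds.
    have [_ /andP[]] := sD d ds; rewrite {1}W210 => dW _.
    have [x sx dE] := val_surj (isT : all prime ps) dW.
    by rewrite dE; apply: map_f; rewrite mem_filter -dE ds mem_pts sx.
  by move=> x _ /sD[_ /andP[]].
apply: step_stair => // [i y|y]; last first.
  by have [B [cB hB _]] := key y; apply: leq_trans hB (cap4 cB).
have [B [cB hB By]] := key y; move=> i20 yi; apply: leq_trans hB _.
pose c := nth (0%num, 0, EmptyString) certificates i.
have [hM hz] : c.1.2 = i /\ N.to_nat c.1.1 = nth 0 zs210 i.
  have /allP/(_ i) : all (fun i => let c := nth (0%num, 0, EmptyString) certificates i in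
      (c.1.2 == i) && (N.to_nat c.1.1 == nth 0 zs210 i)) (iota 0 20) by vm_compute.
  by rewrite mem_iota => /(_ i20)/andP[/eqP ? /eqP].
have cIn : List.In (c.1.1, c.1.2, c.2) certificates.
  rewrite -!surjective_pairing /c; have : i < size certificates by [].
  by elim: certificates (i) => // d l IH [|k] /= hk; [left|right; exact: IH].
rewrite -hM; apply: (cap_below cIn cB) => x sx Bx.
have := leq_ltn_trans (By x sx Bx) yi; rewrite -hz -valN_val //.
by case: N.ltb_spec => //; lia.
Qed.

(** * Caps among the divisors of 2310^2 *)

(* The (i+1)-st list is a cap with i+1 elements; a computer search found them
   so as to make the largest elements small. *)
Definition caps2310 : seq (seq nat) := [::
    [:: 1];
    [:: 1; 2];
    [:: 1; 2; 3];
    [:: 1; 2; 3; 5];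
    [:: 1; 2; 3; 5; 6];
    [:: 1; 2; 3; 5; 6; 7];
    [:: 1; 2; 3; 5; 6; 7; 10];
    [:: 1; 2; 3; 5; 6; 7; 10; 11];
    [:: 1; 2; 3; 5; 6; 7; 10; 11; 14];
    [:: 1; 2; 3; 5; 6; 7; 10; 11; 14; 15];
    [:: 1; 2; 3; 5; 6; 7; 10; 11; 14; 15; 21];
    [:: 1; 2; 3; 5; 6; 7; 10; 11; 14; 15; 21; 22];
    [:: 4; 5; 6; 7; 11; 12; 14; 15; 18; 20; 21; 22; 25];
    [:: 4; 5; 6; 7; 11; 12; 14; 15; 18; 20; 21; 22; 25; 30];
    [:: 4; 5; 6; 7; 11; 12; 14; 15; 18; 20; 21; 22; 25; 30; 33];
    [:: 4; 5; 6; 7; 11; 12; 14; 15; 18; 20; 21; 22; 25; 30; 33; 35];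
    [:: 4; 5; 6; 7; 11; 12; 14; 15; 18; 20; 21; 22; 25; 30; 33; 35; 42];
    [:: 4; 5; 6; 7; 11; 12; 14; 15; 18; 20; 21; 22; 25; 30; 33; 35; 42; 55];
    [:: 4; 6; 7; 10; 11; 12; 15; 18; 20; 21; 28; 33; 35; 42; 44; 49; 50; 55;
    60];
    [:: 4; 6; 7; 10; 11; 12; 15; 18; 20; 21; 28; 33; 35; 42; 44; 49; 50; 55;
    60; 66];
    [:: 4; 6; 7; 10; 11; 12; 15; 18; 20; 21; 28; 33; 35; 42; 44; 49; 50; 55;
    60; 66; 70];
    [:: 4; 6; 7; 10; 11; 12; 15; 18; 20; 21; 28; 33; 35; 42; 44; 49; 50; 55;
    60; 66; 70; 77];
    [:: 4; 6; 7; 10; 11; 12; 15; 18; 20; 21; 28; 33; 35; 42; 44; 49; 50; 55;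
    60; 66; 70; 77; 105];
    [:: 4; 6; 7; 10; 11; 12; 15; 18; 20; 21; 28; 33; 35; 42; 44; 49; 50; 55;
    60; 66; 70; 77; 105; 110];
    [:: 2; 3; 5; 7; 10; 11; 12; 18; 21; 22; 28; 33; 35; 45; 55; 66; 70; 75;
    77; 84; 90; 98; 105; 110; 121];
    [:: 2; 3; 5; 7; 10; 11; 12; 18; 21; 22; 28; 33; 35; 45; 55; 66; 70; 75;
    77; 84; 90; 98; 105; 110; 121; 154];
    [:: 2; 3; 5; 7; 10; 11; 12; 18; 21; 22; 28; 33; 35; 45; 55; 66; 70; 75;
    77; 84; 90; 98; 105; 110; 121; 154; 165];
    [:: 2; 3; 5; 7; 10; 11; 12; 18; 21; 22; 28; 33; 35; 45; 55; 66; 70; 75;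
    77; 84; 90; 98; 105; 110; 121; 154; 165; 210];
    [:: 1; 2; 7; 18; 20; 21; 22; 30; 33; 36; 42; 55; 70; 77; 90; 99; 100; 105;
    121; 126; 140; 147; 154; 165; 175; 180; 198; 210; 220];
    [:: 1; 2; 7; 18; 20; 21; 22; 30; 33; 36; 42; 55; 70; 77; 90; 99; 100; 105;
    121; 126; 140; 147; 154; 165; 175; 180; 198; 210; 220; 231];
    [:: 14; 15; 18; 21; 22; 25; 30; 33; 35; 45; 55; 70; 77; 84; 90; 98; 105;
    110; 126; 132; 150; 165; 175; 198; 210; 225; 231; 242; 275; 300; 308];
    [:: 14; 15; 18; 21; 22; 25; 30; 33; 35; 45; 55; 70; 77; 84; 90; 98; 105;
    110; 126; 132; 150; 165; 175; 198; 210; 225; 231; 242; 275; 300; 308; 330];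
    [:: 14; 15; 18; 21; 22; 25; 30; 33; 35; 45; 55; 70; 77; 84; 90; 98; 105;
    110; 126; 132; 150; 165; 175; 198; 210; 225; 231; 242; 275; 300; 308; 330;
    385];
    [:: 14; 15; 18; 21; 22; 25; 30; 33; 35; 45; 55; 70; 77; 84; 90; 98; 105;
    110; 126; 132; 150; 165; 175; 198; 210; 225; 231; 242; 275; 300; 308; 330;
    385; 462];
    [:: 1; 2; 12; 15; 30; 36; 42; 45; 66; 70; 77; 84; 90; 98; 100; 105; 110;
    126; 132; 140; 165; 175; 198; 220; 231; 242; 252; 275; 308; 315; 385; 396;
    462; 490; 495];
    [:: 1; 2; 12; 15; 30; 36; 42; 45; 66; 70; 77; 84; 90; 98; 100; 105; 110;
    126; 132; 140; 165; 175; 198; 220; 231; 242; 252; 275; 308; 315; 385; 396;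
    462; 490; 495; 770];
    [:: 1; 3; 10; 18; 20; 22; 30; 36; 42; 44; 55; 60; 70; 77; 84; 105; 121;
    126; 140; 147; 175; 198; 225; 231; 252; 308; 315; 330; 385; 396; 462; 495;
    605; 660; 735; 770; 825];
    [:: 1; 3; 10; 18; 20; 22; 30; 36; 42; 44; 55; 60; 70; 77; 84; 105; 121;
    126; 140; 147; 175; 198; 225; 231; 252; 308; 315; 330; 385; 396; 462; 495;
    605; 660; 735; 770; 825; 1155];
    [:: 5; 7; 11; 22; 30; 33; 42; 45; 55; 60; 63; 66; 70; 77; 84; 98; 121;
    175; 242; 245; 330; 350; 363; 385; 462; 490; 495; 525; 550; 660; 693; 726;
    735; 924; 1050; 1078; 1155; 1470; 1540];
    [:: 5; 14; 15; 21; 22; 28; 30; 42; 55; 66; 75; 77; 90; 98; 110; 121; 132;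
    154; 175; 231; 245; 350; 363; 396; 490; 525; 539; 726; 770; 924; 990;
    1155; 1225; 1470; 1540; 1815; 1980; 2100; 2178; 2205];
    [:: 5; 14; 15; 21; 22; 28; 30; 42; 55; 66; 75; 77; 90; 98; 110; 121; 132;
    154; 175; 231; 245; 350; 363; 396; 490; 525; 539; 726; 770; 924; 990;
    1155; 1225; 1470; 1540; 1815; 1980; 2100; 2178; 2205; 2310]].

Definition zs2310 : seq nat := map (last 0) caps2310.

(** The largest listed cap with all elements at most z; the empty list in front serves z = 0. *)
Definition cap2310 (z : nat) : seq nat := nth [::] ([::] :: caps2310) (step zs2310 z).

Definition trit_of (n : nat) : trit := nth T0 trits (n %% 3).

Definition cube_class (ps : seq nat) (m : nat) : seq trit :=
  [seq trit_of (logn p m) | p <- ps].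

Lemma trit_of_third a b c x : a + b + c = 3 * x ->
  trit_of c = tthird (trit_of a) (trit_of b).
Proof.
move=> e; rewrite /trit_of.
have -> : c %% 3 = (2 * (a %% 3) + 2 * (b %% 3)) %% 3 by lia.
have : a %% 3 < 3 by rewrite ltn_mod.
have : b %% 3 < 3 by rewrite ltn_mod.
by move: (a %% 3) (b %% 3) => [|[|[|?]]] [|[|[|?]]].
Qed.

Lemma cube_class_third ps a b c x : 0 < a -> 0 < b -> 0 < c ->
  a * b * c = x ^ 3 ->
  cube_class ps c = third (cube_class ps a) (cube_class ps b).
Proof.
move=> a0 b0 c0 e; elim: ps => //= p ps ->; congr (_ :: _).
apply: (@trit_of_third _ _ _ (logn p x)).
by rewrite -lognX -e !lognM ?muln_gt0 ?a0.
Qed.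

Definition good_check (ps s : seq nat) : bool :=
  let ks := [seq cube_class ps m | m <- s] in
  uniq ks && all (fun k => all (fun l => (k == l) || (third k l \notin ks)) ks) ks.

Lemma third_self x : third x x = x.
Proof. by elim: x => //= a x ->; case: a. Qed.

(** If a b c is a cube, the class of c is the third point for those of a and b. The check forces the
    latter two to coincide; then c has the same class, and distinct elements have distinct
    classes. *)
Lemma good_checkP ps s : all (leq 1) s -> good_check ps s ->
  good (fun m => m \in s).
Proof.
move=> /allP s0 /andP[us hs] a b c x sa sb sc e.
have inj := uniq_map_inj us.
have h := cube_class_third ps (s0 _ sa) (s0 _ sb) (s0 _ sc) e.
have ab : a = b.
  apply: inj => //; apply/eqP.
  have /allP/(_ _ (map_f _ sb)) := allP hs _ (map_f (cube_class ps) sa).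
  by rewrite -h map_f // orbF.
split=> //; apply: inj => //; rewrite h -ab third_self //.
Qed.

(** Divisibility of 2310^2 by q is tested by a binary division with exact product, which avoids
    unary numbers of that size. *)
Definition caps_check : bool :=
  [&& sorted leq zs2310, [seq size s | s <- caps2310] == iota 1 41 &
   all (fun s => [&& all (leq 1) s, all (geq (last 0 s)) s, uniq s,
     good_check [:: 2; 3; 5; 7; 11] s &
     all (fun m => let q := N.of_nat m in
       N.eqb (q * (N.pow 2310 2 / q))%num (N.pow 2310 2)) s]) caps2310].

Lemma caps_check_true : caps_check. Proof. by vm_compute. Qed.

Lemma step_nth (zs : seq nat) z : sorted leq zs -> 0 < step zs z ->
  nth 0 zs (step zs z).-1 <= z.
Proof.
move=> so; case E: (step zs z) => [|k] // _ /=.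
have kn : k < size zs by rewrite -E count_size.
rewrite leqNgt; apply/negP => zk.
have : step zs z = count (fun j => j <= z) (take k zs) + count (fun j => j <= z) (drop k zs).
  by rewrite -count_cat cat_take_drop.
have -> : count (fun j => j <= z) (drop k zs) = 0.
  apply/eqP; rewrite -leqn0 leqNgt -has_count; apply/(has_nthP 0) => -[i].
  rewrite size_drop nth_drop => ik; rewrite leqNgt => /negP; apply.
  apply: leq_trans zk _; apply: (sorted_leq_nth leq_trans leqnn) => //.
  - by rewrite inE; lia.
  - exact: leq_addr.
have := count_size (fun j => j <= z) (take k zs); rewrite size_takel; last exact: ltnW.
by rewrite E; lia.
Qed.

Lemma cap2310P z : [/\ uniq (cap2310 z), size (cap2310 z) = step zs2310 z,
  (forall q, q \in cap2310 z -> q %| 2310 ^ 2 /\ q <= z) &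
  good (fun q => q \in cap2310 z)].
Proof.
have /and3P[so /eqP sz /allP hc] := caps_check_true.
have sc : size caps2310 = 41 by rewrite -(size_map size) sz size_iota.
have := count_size (fun j => j <= z) zs2310.
rewrite -/(step zs2310 z) size_map sc => k41.
rewrite /cap2310; case E: (step zs2310 z) => [|k] /=.
  by split=> // a b c x.
have k41' : k < size caps2310 by rewrite sc -E.
have := hc _ (mem_nth [::] k41'); set s := nth _ _ _.
move=> /and5P[s1 /allP sl us gs /allP sd].
have sE : size s = k.+1.
  by rewrite /s -(nth_map _ 0) // sz nth_iota // -sc.
split=> // [q qs|]; last exact: good_checkP gs.
split.
  have /N.eqb_spec h := sd q qs; apply/dvdnP.
  exists (N.to_nat (N.pow 2310 2 / N.of_nat q)).
  have e : N.to_nat 2310 = 2310 by [].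
  have := congr1 N.to_nat h; rewrite N.pow_2_r !N2Nat.inj_mul Nat2N.id e !multE.
  by rewrite mulnn mulnC => <-.
have := step_nth so (z := z); rewrite E => /(_ isT) /=.
rewrite (nth_map [::]) // => h; apply: leq_trans h; exact: sl.
Qed.

(** * Densities *)

(** The list repeats each j up to J as often as g increases at j. *)
Lemma step_repr (g : nat -> nat) J : g 0 = 0 -> {homo g : x y / x <= y} ->
  (forall z, J <= z -> g z = g J) ->
  exists zs, all (leq 1) zs /\ forall z, g z = step zs z.
Proof.
move=> g0 gm gJ; pose zs k := flatten [seq nseq (g j - g j.-1) j | j <- iota 1 k].
exists (zs J); split.
  apply/allP => j /flatten_mapP[i]; rewrite mem_iota => /andP[i1 _].
  by rewrite mem_nseq => /andP[_ /eqP ->].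
move=> z; have -> : g z = g (minn z J).
  by case: (leqP z J) => // zJ; rewrite gJ ?(ltnW zJ).
elim: J {gJ} => [|J IH]; first by rewrite minn0 g0.
rewrite /zs -[J.+1]addn1 iotaD map_cat flatten_cat /step count_cat addn1.
rewrite -/(zs J) -/(step (zs J) z) -IH /= cats0 count_nseq add1n.
case: (leqP z J) => zJ.
  by rewrite (minn_idPl (leqW zJ)) addn0.
by rewrite (minn_idPr zJ) mul1n subnKC // gm.
Qed.

Lemma maxgood_smooth_repr W : 0 < W ->
  exists zs, all (leq 1) zs /\ forall z, maxgood_smooth W z = step zs z.
Proof.
move=> W0; have W2 : 0 < W ^ 2 by rewrite expn_gt0 W0.
apply: (step_repr (J := W ^ 2)).
- have [s [us sD _]] := maxgood_ex (W ^ 2) (fun d => (d %| W ^ 2) && (d <= 0)).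
  rewrite /maxgood_smooth => <-; case: s us sD => // d s _ /(_ d (mem_head _ _)).
  by rewrite leqn0 => -[_ /andP[h /eqP d0]]; move: h; rewrite d0 dvd0n eqn0Ngt W2.
- move=> x y xy.
  have [s [us sD gs sE]] := maxgood_ex (W ^ 2) (fun d => (d %| W ^ 2) && (d <= x)).
  rewrite /maxgood_smooth -sE; apply: maxgood_ge => // m /sD[-> /andP[-> mx]].
  by rewrite (leq_trans mx xy).
move=> z Wz; apply: eq_bigl => A; congr (_ && _).
apply: eq_forallb_in => a aA; congr (_ && _).
have aW : (a <= W ^ 2)%N by rewrite -ltnS ltn_ord.
by rewrite aW (leq_trans aW Wz).
Qed.

Definition rough_sum (W : nat) (g : nat -> nat) (n : nat) : nat :=
  \sum_(t <- iota 1 n | coprime t W) g (n %/ t).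

Definition cap_family W (C : nat -> seq nat) : Prop := forall z,
  [/\ uniq (C z), (forall q, q \in C z -> q %| W ^ 2 /\ q <= z) &
      good (fun q => q \in C z)].

Lemma rough_sum_le W C n : 0 < W -> cap_family W C ->
  rough_sum W (fun z => size (C z)) n <= n.
Proof.
move=> W0 hC; apply: (@size_products_le W n C (fun t => coprime t W)) => //.
- by move=> z; have [] := hC z.
- by move=> z q; have [_ h _] := hC z; exact: h.
Qed.

Lemma rough_sum_le_fmax W C n y : 0 < W -> cap_family W C ->
  rough_sum W (fun z => size (C z)) n <= fmax 3 3 n +
    \sum_(p <- iota 1 y | prime p && ~~ (p %| W))
      rough_sum W (fun z => size (C z)) (n %/ p ^ 2) +
    \sum_(p <- iota y.+1 n) rough_sum W (fun z => size (C z)) (n %/ p ^ 2).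
Proof.
move=> W0 hC; set S := rough_sum W _; apply: leq_trans (squarefree_loss n (fun z => size (C z)) W0) _.
rewrite -addnA; apply: leq_add.
  apply: (@fmax_lower W n C (fun t => coprime t W && squarefree t)) => //.
  - by move=> z; have [] := hC z.
  - by move=> z q; have [_ h _] := hC z; exact: h.
  - by move=> t /andP[].
  - by move=> t /andP[].
  by move=> z; have [] := hC z.
(* Enlarging the range to y + n allows the split at y without comparing y with n. *)
apply: (@leq_trans (\sum_(p <- iota 1 (y + n) | prime p && ~~ (p %| W))
  S (n %/ p ^ 2))).
  by rewrite [y + n]addnC iotaD big_cat leq_addr.
rewrite iotaD big_cat add1n leq_add2l.
by rewrite big_mkcond; apply: leq_sum => p _; case: ifP.
Qed.

Lemma maxgood_family W : exists C, cap_family W C /\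
  forall z, size (C z) = maxgood_smooth W z.
Proof.
have /choice[C hC] z := maxgood_ex (W ^ 2) (fun d => (d %| W ^ 2) && (d <= z)).
exists C; split=> z; have [uC sC gC eC] := hC z => //.
by split=> // q /sC[_ /andP[]].
Qed.

From mathcomp Require Import all_classical all_reals all_analysis.

Import Order.TTheory GRing.Theory Num.Theory.
Import numFieldNormedType.Exports.
Local Open Scope classical_set_scope.
Local Open Scope ring_scope.

Section Real.

Variable R : realType.
Implicit Types (W n : nat) (zs : seq nat).

Definition rough_density W : R := (totient W)%:R / W%:R.
Definition step_density W zs : R := rough_density W * \sum_(j <- zs) j%:R^-1.

Lemma rough_density_ge0 W : 0 <= rough_density W.
Proof. by rewrite divr_ge0. Qed.

Lemma rough_approx W m : (0 < W)%N ->
  `|(rough W m)%:R - rough_density W * m%:R| <= (totient W)%:R :> R.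
Proof.
move=> W0; have /andP[h1 h2] := rough_bounds m W0.
have Wr : 0 < W%:R :> R by rewrite ltr0n.
set a := (m %/ W)%N in h1 h2; set p := totient W in h1 h2 *.
have a1 : a%:R <= m%:R / W%:R :> R.
  by rewrite ler_pdivlMr // -natrM ler_nat leq_trunc_div.
have a2 : m%:R / W%:R <= a%:R + 1 :> R.
  by rewrite ler_pdivrMr // natr1 -natrM ler_nat ltnW // ltn_ceil.
have p0 : 0 <= p%:R :> R by [].
have e : rough_density W * m%:R = p%:R * (m%:R / W%:R).
  by rewrite /rough_density; ring.
have {}h1 : a%:R * p%:R <= (rough W m)%:R :> R by rewrite -natrM ler_nat.
have {}h2 : (rough W m)%:R <= (a%:R + 1) * p%:R :> R by rewrite natr1 -natrM ler_nat.
rewrite e ler_norml; apply/andP; split; nra.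
Qed.

Lemma floor_div_bounds n j : (0 < j)%N ->
  (n %/ j)%:R <= n%:R / j%:R :> R /\ n%:R / j%:R - 1 <= (n %/ j)%:R :> R.
Proof.
move=> j0; have jr : 0 < j%:R :> R by rewrite ltr0n.
split; first by rewrite ler_pdivlMr // -natrM ler_nat leq_trunc_div.
rewrite lerBlDr ler_pdivrMr // natr1 -natrM ler_nat ltnW // ltn_ceil //.
Qed.

Lemma rough_density_le_totient W : (0 < W)%N -> rough_density W <= (totient W)%:R.
Proof.
move=> W0; rewrite /rough_density ler_pdivrMr ?ltr0n //.
by rewrite -natrM ler_nat leq_pmulr.
Qed.

(** Each jump j costs at most [totient W] for the count up to n / j and at most [rough_density W] <=
    [totient W] for rounding n / j down. *)
Lemma rough_sum_approx W zs n : (0 < W)%N -> all (leq 1) zs ->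
  `|(rough_sum W (step zs) n)%:R - step_density W zs * n%:R| <=
  (2 * totient W * size zs)%:R :> R.
Proof.
move=> W0 z1; rewrite /rough_sum sum_step // /step_density.
elim: zs z1 => [|j zs IH] /=.
  by move=> _; rewrite !big_nil mulr0 mul0r subrr normr0.
move=> /andP[j0 /IH{}IH]; rewrite !big_cons natrD mulnS natrD mulrDr mulrDl.
rewrite opprD addrACA; apply: le_trans (ler_normD _ _) _; apply: lerD => //.
have [f1 f2] := floor_div_bounds n j0.
have r := rough_approx (n %/ j) W0.
have d0 := rough_density_ge0 W; have d1 := rough_density_le_totient W0.
move: r f1 f2 d0 d1; rewrite mul2n -addnn natrD -mulrA [j%:R^-1 * _]mulrC.
move: (rough _ _)%:R (rough_density W) (totient W)%:R ((n %/ j)%:R : R) (n%:R / j%:R) => r d p a b.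
rewrite !ler_norml => /andP[h1 h2] f1 f2 d0 d1; apply/andP; split; nra.
Qed.

(** Telescoping, from 1 / p^2 <= 1 / (p - 1) - 1 / p. *)
Lemma sum_inv_sqr y k : (0 < y)%N ->
  \sum_(p <- iota y.+1 k) (p ^ 2)%:R^-1 <= y%:R^-1 - (y + k)%:R^-1 :> R.
Proof.
move=> y0; elim: k => [|k IH]; first by rewrite big_nil addn0 subrr.
rewrite -[in iota _ _](addn1 k) iotaD big_cat big_seq1 /=.
apply: le_trans (lerD IH (lexx _)) _.
rewrite addSn addnS -[(y + k).+1]addn1.
have : 0 < (y + k)%:R :> R by rewrite ltr0n addn_gt0 y0.
rewrite natrX [(y + k + 1)%:R]natrD; move: (y%:R^-1) ((y + k)%:R : R) => b x x0.
have xn : x != 0 by rewrite gt_eqF.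
have x1n : x + 1 != 0 by apply: lt0r_neq0; lra.
have h : x^-1 - (x + 1)^-1 - ((x + 1) ^+ 2)^-1 = (x * (x + 1) ^+ 2)^-1.
  by field; rewrite xn x1n.
have : 0 <= (x * (x + 1) ^+ 2)^-1 by rewrite invr_ge0 mulr_ge0 ?exprn_ge0 //; lra.
by rewrite -h; lra.
Qed.

Lemma large_loss W (g : nat -> nat) n y : (0 < y)%N ->
  (forall m, rough_sum W g m <= m)%N ->
  \sum_(p <- iota y.+1 n) (rough_sum W g (n %/ p ^ 2)%N)%:R <= n%:R / y%:R :> R.
Proof.
move=> y0 hg; apply: (@le_trans _ _ (\sum_(p <- iota y.+1 n) n%:R * (p ^ 2)%:R^-1)).
  rewrite !big_seq; apply: ler_sum => p; rewrite mem_iota => /andP[yp _].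
  have p0 : (0 < p ^ 2)%N by rewrite expn_gt0 (leq_ltn_trans _ yp).
  by apply: le_trans (floor_div_bounds n p0).1; rewrite ler_nat.
rewrite -big_distrr ler_wpM2l //; apply: le_trans (sum_inv_sqr _ y0) _.
by rewrite lerBlDr lerDl invr_ge0.
Qed.

Lemma fmax_le W zs n : (0 < W)%N -> all (leq 1) zs ->
  (forall z, maxgood_smooth W z <= step zs z)%N ->
  (fmax 3 3 n)%:R <= step_density W zs * n%:R + (2 * totient W * size zs)%:R.
Proof.
move=> W0 z1 hz; have := rough_sum_approx n W0 z1.
rewrite ler_norml => /andP[_ h].
have : (fmax 3 3 n)%:R <= (rough_sum W (step zs) n)%:R :> R.
  rewrite ler_nat; apply: leq_trans (fmax_upper n W0) _.
  by apply: leq_sum => t _; exact: hz.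
lra.
Qed.

(** Every S(m) in [rough_sum_le_fmax] is replaced by V m with error at most K, once for m = n and
    once for each p in P; the part beyond y costs at most n / y. *)
Lemma fmax_ge W C zs n y P (K : R) :
  P = [seq p <- iota 1 y | prime p && ~~ (p %| W)%N] ->
  K = (2 * totient W * size zs)%:R -> (0 < W)%N -> (0 < y)%N -> all (leq 1) zs ->
  cap_family W C -> (forall z, size (C z) = step zs z) ->
  (step_density W zs * (1 - \sum_(p <- P) (p ^ 2)%:R^-1) - y%:R^-1) * n%:R
    - K * (1 + (size P)%:R) <= (fmax 3 3 n)%:R.
Proof.
move=> PE KE W0 y0 z1 hC sC; set V := step_density W zs.
have := rough_sum_le_fmax n y W0 hC; rewrite -big_filter -PE.
have -> : (fun z => size (C z)) = step zs by apply/funext => z; exact: sC.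
rewrite -(ler_nat R) !natrD [X in _ + X + _]natr_sum [X in _ + _ + X]natr_sum.
have hS m : `|(rough_sum W (step zs) m)%:R - V * m%:R| <= K.
  by rewrite KE; exact: rough_sum_approx.
have tail := @large_loss W (step zs) n y y0 _.
have {}tail : \sum_(p <- iota y.+1 n) (rough_sum W (step zs) (n %/ p ^ 2)%N)%:R <= n%:R / y%:R :> R.
  apply: tail => m; have := @rough_sum_le W C m W0 hC.
  by have -> : (fun z => size (C z)) = step zs by apply/funext => z; exact: sC.
have V0 : 0 <= V.
  rewrite mulr_ge0 ?rough_density_ge0 // sumr_ge0 // => j _; by rewrite invr_ge0.
have small : \sum_(p <- P) (rough_sum W (step zs) (n %/ p ^ 2)%N)%:R <=
    V * n%:R * \sum_(p <- P) (p ^ 2)%:R^-1 + K * (size P)%:R :> R.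
  rewrite big_distrr /= -(sum1_size P) natr_sum big_distrr -big_split /= !big_seq.
  apply: ler_sum => p; rewrite PE mem_filter => /andP[/andP[pp _] _].
  have p0 : (0 < p ^ 2)%N by rewrite expn_gt0 prime_gt0.
  have := hS (n %/ p ^ 2)%N; rewrite ler_norml => /andP[_ h].
  have [f1 _] := floor_div_bounds n p0.
  have := ler_wpM2l V0 f1; rewrite mulrA mulr1; move: h.
  move: (V * (n %/ p ^ 2)%:R) (V * n%:R / (p ^ 2)%:R) (rough_sum _ _ _)%:R => u v r.
  lra.
have := hS n; rewrite ler_norml => /andP[h _] main.
move: main tail small h; rewrite mulrDl mulNr [y%:R^-1 * _]mulrC.
move: (\sum_(p <- iota _ _) _) (\sum_(p <- P) (rough_sum _ _ _)%:R) => t s.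
move: (rough_sum _ _ _)%:R (fmax 3 3 n)%:R (n%:R) (size P)%:R (\sum_(p <- P) _).
move: (y%:R^-1) => r f x k u w main tail small h.
nra.
Qed.

(** For W = y! all primes up to y divide W, so of the loss only the tail n / y remains. *)
Lemma fmax_approx y : (0 < y)%N -> exists V K : R, forall n,
  V * n%:R - n%:R / y%:R - K <= (fmax 3 3 n)%:R <= V * n%:R + K.
Proof.
move=> y0; have W0 := fact_gt0 y; set W := y`! in W0.
have [zs [z1 hz]] := maxgood_smooth_repr W0.
have [C [hC sC]] := maxgood_family W.
exists (step_density W zs), (2 * totient W * size zs)%:R => n.
rewrite fmax_le ?andbT //; last by move=> z; rewrite hz.
have := fmax_ge n erefl erefl W0 y0 z1 hC (fun z => etrans (sC z) (hz z)).
have -> : [seq p <- iota 1 y | prime p && ~~ (p %| W)%N] = [::].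
  rewrite (eq_in_filter (a2 := pred0)) ?filter_pred0 // => p.
  rewrite mem_iota add1n ltnS => /andP[p1 py]; rewrite dvdn_fact ?andbF //.
  by rewrite p1 py.
rewrite /= big_nil subr0 mulr1 addr0 mulr1 mulrBl [y%:R^-1 * _]mulrC; lra.
Qed.

(** * Numerical bounds for sums of reciprocals *)

Definition inv_sum_floor (K : N) (s : seq N) : N :=
  foldr (fun j a => (K / j + a)%num) 0%num s.
Definition inv_sum_ceil (K : N) (s : seq N) : N :=
  foldr (fun j a => (K / j + 1 + a)%num) 0%num s.

Local Notation nr a := ((N.to_nat a)%:R : R).

(** Fixed-point arithmetic with denominator K: each reciprocal is rounded to a multiple of 1 / K, so
    that the sums are evaluated in binary integers. *)
Lemma inv_sum_floorP K s : (0 < K)%num -> all (fun j => (0 <? j)%num) s ->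
  nr (inv_sum_floor K s) / nr K <= \sum_(j <- s) (nr j)^-1.
Proof.
move=> K0; have Kr : 0 < nr K by rewrite ltr0n; lia.
elim: s => [|j s IH] /=; first by rewrite big_nil mul0r.
move=> /andP[/N.ltb_spec0 j0 /IH{}IH]; rewrite big_cons N2Nat.inj_add natrD mulrDl.
apply: lerD => //; have jr : 0 < nr j by rewrite ltr0n; lia.
rewrite ler_pdivrMr // mulrC ler_pdivlMr // -natrM ler_nat.
have := N.Div0.mul_div_le K j; move: (K / j)%num => q; lia.
Qed.

Lemma inv_sum_ceilP K s : (0 < K)%num -> all (fun j => (0 <? j)%num) s ->
  \sum_(j <- s) (nr j)^-1 <= nr (inv_sum_ceil K s) / nr K.
Proof.
move=> K0; have Kr : 0 < nr K by rewrite ltr0n; lia.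
elim: s => [|j s IH] /=; first by rewrite big_nil mul0r.
move=> /andP[/N.ltb_spec0 j0 /IH{}IH]; rewrite big_cons N2Nat.inj_add natrD mulrDl.
apply: lerD => //; have jr : 0 < nr j by rewrite ltr0n; lia.
rewrite ler_pdivlMr // mulrC ler_pdivrMr // -natrM ler_nat.
have := N.mul_succ_div_gt K j; move: (K / j)%num => q; lia.
Qed.

Lemma inv_sum_le (K c d : N) s :
  [&& 0 <? K, 0 <? d, all (fun j => 0 <? j) s & inv_sum_ceil K s * d <=? c * K]%num ->
  \sum_(j <- s) (nr j)^-1 <= nr c / nr d.
Proof.
move=> /and4P[/N.ltb_spec0 K0 /N.ltb_spec0 d0 s0 /N.leb_spec0 h].
apply: le_trans (inv_sum_ceilP K0 s0) _.
have Kr : 0 < nr K by rewrite ltr0n; lia.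
have dr : 0 < nr d by rewrite ltr0n; lia.
by rewrite ler_pdivrMr // mulrAC ler_pdivlMr // -!natrM ler_nat; lia.
Qed.

Lemma inv_sum_ge (K c d : N) s :
  [&& 0 <? K, 0 <? d, all (fun j => 0 <? j) s & c * K <=? inv_sum_floor K s * d]%num ->
  nr c / nr d <= \sum_(j <- s) (nr j)^-1.
Proof.
move=> /and4P[/N.ltb_spec0 K0 /N.ltb_spec0 d0 s0 /N.leb_spec0 h].
apply: le_trans (inv_sum_floorP K0 s0).
have Kr : 0 < nr K by rewrite ltr0n; lia.
have dr : 0 < nr d by rewrite ltr0n; lia.
by rewrite ler_pdivrMr // mulrAC ler_pdivlMr // -!natrM ler_nat; lia.
Qed.

Lemma sum_inv_of_nat (s : seq nat) :
  \sum_(j <- map N.of_nat s) (nr j)^-1 = \sum_(j <- s) j%:R^-1.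
Proof. by rewrite big_map; apply: eq_bigr => j _; rewrite Nat2N.id. Qed.

(** The margin 10^-5 absorbs the bounded error after division by n. The value is about 48 / 210 *
    2.80867 = 0.64198. *)
Lemma step_density210 : step_density 210 zs210 <= 6420 / 10 ^+ 4 - 10 ^- 5.
Proof.
have : \sum_(j <- zs210) j%:R^-1 <= nr 8426 / nr 3000.
  rewrite -sum_inv_of_nat; apply: (@inv_sum_le 1000000); by vm_compute.
have -> : N.to_nat 8426 = 8426%N by vm_compute.
have -> : N.to_nat 3000 = 3000%N by vm_compute.
rewrite /step_density /rough_density.
have -> : totient 210 = 48%N by vm_compute.
by move: (\sum_(j <- _) _) => s h; lra.
Qed.

Lemma step_density2310 : 6377 / 10 ^+ 4 <= step_density 2310 zs2310.
Proof.
have : nr 3069 / nr 1000 <= \sum_(j <- zs2310) j%:R^-1.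
  rewrite -sum_inv_of_nat; apply: (@inv_sum_ge 1000000); by vm_compute.
have -> : N.to_nat 3069 = 3069%N by vm_compute.
have -> : N.to_nat 1000 = 1000%N by vm_compute.
rewrite /step_density /rough_density.
have -> : totient 2310 = 480%N by vm_compute.
by move: (\sum_(j <- _) _) => s h; lra.
Qed.

Lemma prime_inv_sqr :
  \sum_(p <- [seq p <- iota 1 1300 | prime p && ~~ (p %| 2310)%N]) (p ^ 2)%:R^-1
    <= 226 / 10 ^+ 4 :> R.
Proof.
set s := (X in \sum_(p <- X) _).
have -> : \sum_(p <- s) (p ^ 2)%:R^-1 =
    \sum_(q <- [seq (N.of_nat p * N.of_nat p)%num | p <- s]) (nr q)^-1.
  by rewrite big_map; apply: eq_bigr => p _; rewrite N2Nat.inj_mul Nat2N.id multE mulnn.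
have -> : 226 / 10 ^+ 4 = nr 226 / nr 10000.
  have -> : N.to_nat 226 = 226%N by vm_compute.
  have -> : N.to_nat 10000 = (10 ^ 4)%N by vm_compute.
  by rewrite natrX.
apply: (@inv_sum_le 1000000); by vm_compute.
Qed.

End Real.

(** * Existence of the limit and its bounds *)

Definition fmax_ratio (R : realType) (n : nat) : R := (fmax 3 3 n)%:R / n%:R.

Lemma near_div_le (R : realType) (K e : R) : 0 < e ->
  \forall n \near \oo, 0 < n%:R :> R /\ K / n%:R <= e.
Proof.
move=> e0; near=> n.
have n0 : 0 < n%:R :> R by rewrite ltr0n; near: n; exact: nbhs_infty_gt.
split=> //; rewrite ler_pdivrMr // mulrC -ler_pdivrMr //.
near: n; exact: nbhs_infty_ger.
Unshelve. all: by end_near. Qed.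

(** For each e the ratios eventually stay in the ball of radius e around a V that depends on e,
    which is the Cauchy property; y is chosen with 1 / y <= e / 4. *)
Lemma fmax_ratio_cvg (R : realType) : cvg (fmax_ratio R n @[n --> \oo]).
Proof.
apply/cauchy_cvgP; apply: cauchy_exP => e e0.
have e4 : 0 < e / 4 by rewrite divr_gt0.
pose y := (Num.truncn (4 / e)).+1.
have ye : y%:R^-1 <= e / 4.
  rewrite -[e / 4]invrK lef_pV2 ?posrE ?invr_gt0 // ?ltr0n //.
  by rewrite invf_div ltW // truncnS_gt.
have [V [K VK]] := @fmax_approx R y isT.
exists V.
suff : \forall n \near \oo, ball V e (fmax_ratio R n) by [].
near=> n; have [n0 Kn] : 0 < n%:R :> R /\ K / n%:R <= e / 4.
  by near: n; exact: near_div_le.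
have /andP[h1 h2] := VK n.
rewrite /= -ball_normE /= ltr_distl /fmax_ratio.
have {}h1 : V - y%:R^-1 - K / n%:R <= (fmax 3 3 n)%:R / n%:R.
  rewrite ler_pdivlMr // !mulrBl divfK ?gt_eqF // [y%:R^-1 * _]mulrC; exact: h1.
have {}h2 : (fmax 3 3 n)%:R / n%:R <= V + K / n%:R.
  by rewrite ler_pdivrMr // mulrDl divfK ?gt_eqF.
by apply/andP; split; lra.
Unshelve. all: by end_near. Qed.

(** Here s is the sum of 1 / p^2 over the primes p up to the cutoff 1300 not dividing 2310, and 1 /
    1300 is the cost of the tail: 0.6377 * 0.9774 - 1 / 1300 exceeds 0.6225. *)
Lemma lower_constant (R : realType) (V s : R) :
  6377 / 10 ^+ 4 <= V -> s <= 226 / 10 ^+ 4 ->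
  6224 / 10 ^+ 4 + 10 ^- 5 <= V * (1 - s) - 1300%:R^-1.
Proof. by move=> hV hs; nra. Qed.

Theorem theorem3 (R : realType) :
  exists c : R,
    6224 / 10 ^+ 4 <= c <= 6420 / 10 ^+ 4 /\
    exists eps : nat -> R,
      eps n @[n --> \oo] --> 0 /\
      forall n : nat, (1 <= n)%N -> (fmax 3 3 n)%:R = (c + eps n) * n%:R.
Proof.
have cv := @fmax_ratio_cvg R; set c := lim (fmax_ratio R n @[n --> \oo]) in cv.
exists c; split; last first.
  exists (fun n => fmax_ratio R n - c); split.
    rewrite -[0](subrr c); apply: cvgB; [exact: cv|exact: cvg_cst].
  by move=> n n0; rewrite addrC subrK divfK // pnatr_eq0 -lt0n.
have d0 : 0 < 10 ^- 5 :> R by rewrite invr_gt0 exprn_gt0.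
apply/andP; split.
  (* Lower bound: [fmax_ge] for the explicit caps with W = 2310 and y = 1300. *)
  apply: limr_ge; first exact: cv.
  have hC : cap_family 2310 cap2310 by move=> z; have [] := cap2310P z.
  have sC z : size (cap2310 z) = step zs2310 z by have [] := cap2310P z.
  have z1 : all (leq 1) zs2310 by vm_compute.
  pose P := [seq p <- iota 1 1300 | prime p && ~~ (p %| 2310)%N].
  pose K : R := (2 * totient 2310 * size zs2310)%:R.
  near=> n.
  have := @fmax_ge R 2310 cap2310 zs2310 n 1300 P K erefl erefl isT isT z1 hC sC.
  have [n0 Kn] : 0 < n%:R :> R /\ K * (1 + (size P)%:R) / n%:R <= 10 ^- 5.
    by near: n; exact: near_div_le.
  have := @lower_constant R _ _ (step_density2310 R) (prime_inv_sqr R); rewrite -/P.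
  move: Kn; clearbody K P; rewrite /fmax_ratio (ler_pdivrMr _ _ n0) (ler_pdivlMr _ _ n0).
  move: (_ - 1300%:R^-1) (K * _) (n%:R : R) n0 => D k x x0 Kn hD.
  apply: le_trans; rewrite lerBrDr; apply: le_trans (lerD (lexx _) Kn) _.
  by rewrite -mulrDl; apply: ler_wpM2r; first exact: ltW.
(* Upper bound: [fmax_le] for W = 210 and the certified steps. *)
apply: limr_le; first exact: cv.
have zs1 : all (leq 1) zs210 by vm_compute.
pose K : R := (2 * totient 210 * size zs210)%:R.
near=> n.
have [n0 h2] : 0 < n%:R :> R /\ K / n%:R <= 10 ^- 5 by near: n; exact: near_div_le.
have := fmax_le R n (isT : (0 < 210)%N) zs1 maxgood_smooth210; rewrite -/K.
clearbody K; move: h2; rewrite /fmax_ratio !(ler_pdivrMr _ _ n0) => h2 h1; apply: le_trans h1 _.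
apply: le_trans (lerD (lexx _) h2) _; rewrite -mulrDl; apply: ler_wpM2r; first exact: ltW.
have := step_density210 R; move: (step_density R 210 zs210) => d; lra.
Unshelve. all: by end_near. Qed.
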